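(* Let $n,k\ge1$ be integers, let $V$ be the $n$-dimensional permutation module over $\mathbb{C}$ of the symmetric group $\mathrm{S}_n$, and let $Z_k(\mathrm{S}_n)=\mathrm{End}_{\mathrm{S}_n}(V^{\otimes k})$. Then for every partition $\lambda$ of $n$, $$\dim Z_k^\lambda(\mathrm{S}_n)=\frac1{n!}\sum_{\sigma\in\mathrm{S}_n}F(\sigma)^k\,\overline{\chi_\lambda(\sigma)}=\sum_{\ell=0}^n \genfrac{\{}{\}}{0pt}{}{k}{\ell}\,K_{\lambda,(n-\ell,1^\ell)},$$ and $$\dim Z_k(\mathrm{S}_n)=\frac1{n!}\sum_{\sigma\in\mathrm{S}_n}F(\sigma)^{2k}=\sum_{\ell=0}^n\genfrac{\{}{\}}{0pt}{}{2k}{\ell}.$$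
   Context: $F(\sigma)$ is the number of fixed points of $\sigma\in\mathrm{S}_n$. $\chi_\lambda$ is the character of the irreducible $\mathrm{S}_n$-module $(\mathrm{S}_n)_\lambda$ labeled by the partition $\lambda\vdash n$ (the trivial module is labeled by $(n)$). $Z_k^\lambda(\mathrm{S}_n)$ is the irreducible module of the semisimple algebra $Z_k(\mathrm{S}_n)$ labeled by $\lambda$, i.e. $V^{\otimes k}\cong\bigoplus_\lambda(\mathrm{S}_n)_\lambda\otimes Z_k^\lambda(\mathrm{S}_n)$ as a bimodule, so that $\dim Z_k^\lambda(\mathrm{S}_n)$ is the multiplicity of $(\mathrm{S}_n)_\lambda$ in $V^{\otimes k}$ (and $Z_k^\lambda(\mathrm{S}_n)=0$ if this multiplicity is $0$). $\genfrac{\{}{\}}{0pt}{}{k}{\ell}$ is the Stirling number of the second kind, the number of partitions of a $k$-element set into $\ell$ nonempty disjoint parts. The Kostka number $K_{\lambda,(n-\ell,1^\ell)}$ is the number of semistandard tableaux of shape $\lambda$ with $n-\ell$ entries equal to $0$ and one entry equal to each of $1,2,\dots,\ell$ (entries weakly increasing across rows and strictly increasing down columns). *)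

(* Defs.v *)
From HB Require Import structures.
From mathcomp Require Import all_boot all_order all_algebra all_fingroup.
From mathcomp Require Import all_character.

Set Implicit Arguments.
Unset Strict Implicit.
Unset Printing Implicit Defensive.

Import GRing.Theory.
Local Open Scope ring_scope.

(* A partition of n is written with exactly n parts, padded with zeros; the
   parts are la_0 >= la_1 >= ... >= la_(n-1) >= 0. *)
Definition is_partition n (la : n.-tuple 'I_n.+1) : bool :=
  let parts := [seq val i | i <- la] in sorted geq parts && (sumn parts == n).

Definition part n := {la : n.-tuple 'I_n.+1 | is_partition la}.
HB.instance Definition _ n := Finite.on (part n).

Definition parts n (la : part n) : seq nat := [seq nat_of_ord i | i <- val la].

Definition in_diagram n (la : part n) (c : 'I_n * 'I_n) : bool :=
  (c.2 < nth 0%N (parts la) c.1)%N.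

Definition cell n (la : part n) := {c : 'I_n * 'I_n | in_diagram la c}.
HB.instance Definition _ n (la : part n) := Finite.on (cell la).

(* The entries of a tableau of content mu = (mu_0, mu_1, ...) are the indices
   of mu. *)
Definition semistandard n (la : part n) (mu : seq nat)
    (T : {ffun cell la -> 'I_(size mu)}) : bool :=
  [&& [forall c : cell la, forall d : cell la, ((val c).1 == (val d).1) &&
         ((val c).2 <= (val d).2)%N ==> (T c <= T d)%N],
      [forall c : cell la, forall d : cell la, ((val c).2 == (val d).2) &&
         ((val c).1 < (val d).1)%N ==> (T c < T d)%N]
    & [forall j, #|[set c | T c == j]| == nth 0%N mu j]].

Definition kostka n (la : part n) (mu : seq nat) : nat :=
  #|[set T : {ffun cell la -> 'I_(size mu)} | semistandard T]|.

Definition stirling2 (k l : nat) : nat :=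
  #|[set P : {set {set 'I_k}} | partition P [set: 'I_k] && (#|P| == l)]|.

Definition fixpts n (s : 'S_n) : nat := #|[set i | s i == i]|.

(* The reference tableau of shape la has the entries 0, ..., n-1 placed in
   order along the first row, then along the second row, and so on. *)
Definition row_of n (la : part n) (i : 'I_n) : nat := reshape_index (parts la) i.
Definition col_of n (la : part n) (i : 'I_n) : nat := reshape_offset (parts la) i.

Definition row_stab n (la : part n) : {set 'S_n} :=
  [set s : 'S_n | [forall i, row_of la (s i) == row_of la i]].
Definition col_stab n (la : part n) : {set 'S_n} :=
  [set s : 'S_n | [forall i, col_of la (s i) == col_of la i]].

Section Modules.

Variable F : fieldType.

(* The symmetric group acts on row vectors from the right, in accordance with
   the product of 'S_n, for which (s * t) i = t (s i). *)

Section Specht.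

Variables (n : nat) (la : part n).

(* The Young symmetrizer (\sum_p p) (\sum_q sgn(q) q), with p preserving rows
   and q preserving columns, as an element of the group algebra, i.e. as a row
   vector of the regular representation. *)
Definition young_symmetrizer : 'rV[F]_#|[set: 'S_n]| :=
  \sum_(p in row_stab la) \sum_(q in col_stab la)
    (-1) ^+ odd_perm q *: delta_mx 0 (gring_index [set: 'S_n] (p * q)%g).

(* The irreducible module labeled by la is the right ideal generated by the
   Young symmetrizer; it is the trivial module when la = (n). *)
Definition specht :=
  submod_repr (cyclic_mx_module (regular_repr F [set: 'S_n])
                                young_symmetrizer).

Definition specht_dim : nat :=
  \rank (cyclic_mx (regular_repr F [set: 'S_n]) young_symmetrizer).

Definition specht_char (s : 'S_n) : F := \tr (specht s).

End Specht.

Lemma permutation_mx_repr n :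
  mx_repr [set: 'S_n] (fun s : 'S_n => perm_mx s : 'M[F]_n).
Proof. by split=> [|s t _ _]; [exact: perm_mx1 | exact: perm_mxM]. Qed.

Definition permutation_repr n := MxRepresentation (permutation_mx_repr n).

Lemma unit_mx_repr n : mx_repr [set: 'S_n] (fun=> 1%:M : 'M[F]_1).
Proof. by split=> // s t _ _; rewrite mulmx1. Qed.

Definition unit_repr n := MxRepresentation (unit_mx_repr n).

Definition tensor_power n k : representation F [set: 'S_n] :=
  iter k (fun W : representation F [set: 'S_n] =>
            Representation (prod_repr (permutation_repr n) W))
         (Representation (unit_repr n)).

Definition tdim n k : nat := rdegree (tensor_power n k).

Definition Zk n k : 'M[F]_(tdim n k ^ 2) :=
  ('C(enveloping_algebra_mx (tensor_power n k)))%MS.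

(* A family (Z_la) of modules over Zk (matrices acting on row vectors from the
   right) together with an isomorphism of bimodules over S_n and Zk from the
   direct sum over la of specht la (x) Z_la to the tensor power of V; zk_emb la
   is its restriction to the summand la.  Only the values of zk_act on Zk
   matter.  That each Z_la is simple or zero is a consequence, by the double
   centralizer theorem, and is not required separately. *)
Record Zk_decomposition n k := ZkDecomposition {
  zk_dim : part n -> nat;
  zk_act : forall la, {linear 'M[F]_(tdim n k) -> 'M[F]_(zk_dim la)};
  zk_emb : forall la, 'M[F]_(specht_dim la * zk_dim la, tdim n k);
  zk_act1 : forall la, zk_act la 1%:M = 1%:M;
  zk_actM : forall la a b, (a \in Zk n k)%MS -> (b \in Zk n k)%MS ->
    zk_act la (a *m b) = zk_act la a *m zk_act la b;
  zk_embJ : forall la (s : 'S_n) a, (a \in Zk n k)%MS ->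
    tprod (specht la s) (zk_act la a) *m zk_emb la
      = zk_emb la *m (tensor_power n k s *m a);
  zk_emb_free : forall la, row_free (zk_emb la);
  zk_emb_direct : mxdirect (\sum_la <<zk_emb la>>)%MS;
  zk_emb_full : (\sum_la <<zk_emb la>> :=: 1%:M)%MS
}.

End Modules.

(* Main.v *)
(** The permutation character of [V^{(x) k}] is [F^k].  Sorting maps
    [k -> n] by their kernel writes it as a combination, with Stirling
    coefficients, of the characters of the permutation modules on words of
    content [(n-l, 1^l)], so the multiplicity formula reduces to Young's rule.

    Group algebra elements are handled as matrices in the regular
    representation.  Von Neumann's lemma on row and column groups makes the
    Young symmetrizers quasi-idempotent; left multiplication by the resulting
    idempotent projects onto the Specht module, so the characters are traces.
    This gives orthonormality of the Specht characters and
    unitriangularity of the pairing with the permutation characters [pi_mu].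

    Kostka numbers count chains of shapes with horizontal strip steps.  A local
    reflection (the Fomin growth rule of RSK) shows that
    [sum_la K(la,alpha) K(la,beta)] is the number of matrices with margins
    [alpha, beta], which is also [<pi_alpha, pi_beta>] by counting orbits on
    pairs of words.  Two unitriangular factorizations of the same Gram matrix
    agree, so [<pi_alpha, chi_la> = K(la, alpha)].

    The dimension of the centralizer is the trace of the averaging projector on
    matrices. *)
Require Import Defs.
From mathcomp Require Import all_boot all_order all_algebra all_fingroup.
From mathcomp Require Import all_character reals complex zify ring.
Set Implicit Arguments.
Unset Strict Implicit.
Unset Printing Implicit Defensive.
Import GRing.Theory Num.Theory.

Local Open Scope nat_scope.

(** * Young diagrams and the row and column groups *)

Section Diagram.
Variable n : nat.
Implicit Types la mu : part n.

(** The group algebra settles only half of the pairing between word characters and Specht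
    characters: von Neumann's lemma gives the value for the content [parts mu] and the shape [la]
    when [weight la <= weight mu]. No homomorphisms indexed by semistandard tableaux are built for
    the other half; the Gram matrix forces it, by downward induction on [weight], a numerical
    stand-in for the dominance order. The contents (n-l, 1^l) need not be partitions: for l = n the
    first entry is 0. Hence the characters of partition contents are expanded first, and an
    arbitrary content is then paired against these expansions. The expansions themselves rest on
    positivity of the bilinear form on real functions, which is one reason for proving that Specht
    characters are real; the other is the conjugate in the theorem. *)

Lemma size_parts la : size (parts la) = n.
Proof. by rewrite size_map size_tuple. Qed.

Lemma sumn_parts la : sumn (parts la) = n.
Proof. by have /andP[_ /eqP] := valP la. Qed.

Lemma sorted_parts la : sorted geq (parts la).
Proof. by have /andP[] := valP la. Qed.

Lemma parts_inj : injective (@parts n).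
Proof.
move=> la mu e; do 2 apply: val_inj => /=.
exact: (inj_map (@ord_inj _)) e.
Qed.

Lemma row_of_lt la i : row_of la i < n.
Proof. by rewrite -{2}(size_parts la) reshape_indexP // sumn_parts. Qed.

Lemma col_of_lt la i : col_of la i < nth 0 (parts la) (row_of la i).
Proof. by apply: reshape_offsetP; rewrite sumn_parts. Qed.

Lemma cell_inj la i j :
  row_of la i = row_of la j -> col_of la i = col_of la j -> i = j.
Proof.
move=> er ec; apply: val_inj; rewrite /= -(reshape_indexK (parts la) i).
by rewrite -(reshape_indexK (parts la) j) [X in flatten_index _ X]er [X in
  flatten_index _ _ X]ec.
Qed.

Lemma cell_surj la x y : y < nth 0 (parts la) x ->
  exists2 i, row_of la i = x & col_of la i = y.
Proof.
move=> yx; have xs : x < size (parts la).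
  by rewrite ltnNge; apply/negP=> h; rewrite nth_default in yx.
have lt : flatten_index (parts la) x y < n.
  by rewrite -{2}(sumn_parts la); apply: flatten_indexP.
exists (Ordinal lt); first exact: flatten_indexKl.
exact: flatten_indexKr.
Qed.

Lemma card_row la x : #|[set i | row_of la i == x]| = nth 0 (parts la) x.
Proof.
set m := nth _ _ _.
(* [inord] needs a nonempty type and [m] may be 0, so the target has one extra element; the image
   misses exactly [ord_max]. *)
pose f (i : 'I_n) : 'I_m.+1 := inord (col_of la i).
have lt i : i \in [set i | row_of la i == x] -> col_of la i < m.
  by rewrite inE /m => /eqP <-; apply: col_of_lt.
rewrite -(card_in_imset (f := f)); last first.
  move=> i j ix jx /(congr1 val); rewrite /= !inordK ?ltnS 1?ltnW ?lt // => ec.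
  by move: ix jx; rewrite !inE => /eqP ix /eqP jx; apply: cell_inj ec; rewrite ix.
have -> : f @: [set i | row_of la i == x] = [set~ ord_max].
  apply/setP=> y; rewrite !inE; apply/imsetP/idP.
    case=> i ix ->; apply/eqP => /(congr1 val) /=.
    rewrite inordK ?ltnS 1?ltnW ?lt // => e; have := lt i ix; lia.
  move=> yn; have ym : y < m.
    by rewrite ltn_neqAle -ltnS ltn_ord andbT; apply: contra yn => /eqP e;
      apply/eqP/val_inj.
  have [i ri ci] := cell_surj ym; exists i; first by rewrite inE ri.
  by apply: val_inj; rewrite /= inordK ci.
by rewrite cardsC1 card_ord.
Qed.

(** Conjugation of partitions: in a weakly decreasing sequence the parts greater than [y] form an
    initial segment, whose length is that of column [y]. *)
Lemma sorted_geq_count s x y : sorted geq s ->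
  (y < nth 0 s x) = (x < count (ltn y) s).
Proof.
elim: s x => [|a s IH] x /=; first by rewrite nth_nil ltn0.
move=> pa; have ss := path_sorted pa.
case: x => [|x] /=.
  case: (ltnP y a) => ya //=; apply/esym/negbTE; rewrite -leqNgt leqn0 add0n.
  rewrite -leqn0 leqNgt -has_count; apply/hasPn => z zs; rewrite -leqNgt.
  apply: leq_trans ya; move: pa; rewrite path_sortedE; last by move=> ? ? ? /= ? ?; lia.
  by case/andP=> /allP/(_ _ zs).
rewrite IH //; case: (ltnP y a) => ya //=.
rewrite add0n; suff -> : count (ltn y) s = 0 by [].
apply/eqP; rewrite -leqn0 leqNgt -has_count; apply/hasPn => z zs; rewrite -leqNgt.
apply: leq_trans ya; move: pa; rewrite path_sortedE; last by move=> ? ? ? /= ? ?; lia.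
by case/andP=> /allP/(_ _ zs).
Qed.

Definition rows_below la t := #|[set i | row_of la i < t]|.
(** The sum of all partial sums of the parts is strictly monotone for dominance, so it replaces that
    partial order by a comparison of numbers. *)
Definition weight la := \sum_(t < n.+1) rows_below la t.

Lemma rows_belowE la t :
  rows_below la t = \sum_(j < t) nth 0 (parts la) j.
Proof.
elim: t => [|t IH]; first by rewrite big_ord0 /rows_below; apply: eq_card0 => i;
  rewrite inE.
rewrite big_ord_recr /= -IH -card_row /rows_below -cardsUI.
rewrite [X in _ = _ + X](_ : _ = 0); last first.
  by apply: eq_card0 => i; rewrite !inE; lia.
by rewrite addn0; apply: eq_card => i; rewrite !inE; lia.
Qed.

Definition col_len la y := count (ltn y) (parts la).

Lemma col_lenP la x y : (y < nth 0 (parts la) x) = (x < col_len la y).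
Proof. exact/sorted_geq_count/sorted_parts. Qed.

Lemma card_col_below la t y :
  #|[set i | (row_of la i < t) && (col_of la i == y)]| = minn t (col_len la y).
Proof.
pose h := col_len la y; rewrite -/h.
have hn : h <= n by rewrite (leq_trans (count_size _ _)) // size_parts.
pose f (i : 'I_n) : 'I_n.+1 := inord (row_of la i).
rewrite -(card_in_imset (f := f)); last first.
  move=> i j; rewrite !inE => /andP[_ /eqP ci] /andP[_ /eqP cj] /(congr1 val).
  rewrite /= !inordK ?ltnS 1?ltnW ?row_of_lt // => er.
  by apply: cell_inj er _; rewrite ci cj.
have lt : minn t h <= n.+1 by lia.
have winj : injective (widen_ord lt) by move=> u v /(congr1 val) /= e; apply: val_inj.
rewrite -[RHS]card_ord -(card_imset predT winj).
apply: eq_card => x; apply/imsetP/imsetP.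
  case=> i; rewrite inE => /andP[iu /eqP ci] ->.
  have ih : row_of la i < minn t h.
    by rewrite leq_min iu /= /h -col_lenP -ci col_of_lt.
  exists (Ordinal ih) => //; apply: val_inj; rewrite /= inordK //.
  by rewrite ltnS ltnW // row_of_lt.
case=> z _ ->; have zu := ltn_ord z.
have : y < nth 0 (parts la) z by rewrite col_lenP -/h; lia.
case/cell_surj=> i ri ci; exists i.
  by rewrite inE ri ci eqxx andbT; lia.
by apply: val_inj; rewrite /= inordK ri //; lia.
Qed.

Lemma card_col la y : #|[set i | col_of la i == y]| = col_len la y.
Proof.
have hn : col_len la y <= n by rewrite (leq_trans (count_size _ _)) // size_parts.
have := card_col_below la n y; rewrite (minn_idPr hn) => <-.
by apply: eq_card => i; rewrite !inE row_of_lt.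
Qed.

Lemma card_split_col (A : {pred 'I_n}) (c : 'I_n -> nat) : (forall i, c i < n) ->
  #|[set i | i \in A]| = \sum_(y < n) #|[set i | (i \in A) && (c i == y)]|.
Proof.
move=> cn; rewrite -sum1_card.
rewrite (partition_big (fun i => Ordinal (cn i)) predT) //=.
apply: eq_bigr => y _; rewrite -sum1_card; apply: eq_bigl => i.
by rewrite !inE -val_eqE.
Qed.

Lemma parts_le la x : nth 0 (parts la) x <= n.
Proof. by rewrite -card_row -[X in _ <= X]card_ord max_card. Qed.

Lemma col_of_ltn la i : col_of la i < n.
Proof. exact: leq_trans (col_of_lt la i) (parts_le _ _). Qed.

Lemma rows_below_col la t :
  rows_below la t = \sum_(y < n) minn t (col_len la y).
Proof.
rewrite /rows_below (card_split_col _ (col_of_ltn la)).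
by apply: eq_bigr => y _; rewrite -card_col_below; apply: eq_card => i; rewrite !inE.
Qed.

Section Dominance.
Variables mu la : part n.
Hypothesis dom : forall t, t <= n -> rows_below mu t <= rows_below la t.

Lemma dominance_weight : weight mu <= weight la.
Proof. by apply: leq_sum => t _; apply: dom; rewrite -ltnS. Qed.

Lemma dominance_rows_eq t : weight mu = weight la -> t <= n ->
  rows_below mu t = rows_below la t.
Proof.
move=> ew tn; have /leqif_sum := fun (t : 'I_n.+1) (_ : true) =>
  leqif_eq (dom (ltn_ord t : t <= n)).
case=> _; rewrite -/(weight mu) -/(weight la) ew eqxx.
by move/esym/forall_inP/(_ (Ordinal (tn : t < n.+1)) isT)/eqP.
Qed.

Lemma dominance_eq : weight mu = weight la -> mu = la.
Proof.
move=> ew; apply: parts_inj; apply: (@eq_from_nth _ 0); rewrite !size_parts //.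
move=> i ltin; have := dominance_rows_eq ew ltin.
by rewrite !rows_belowE !big_ord_recr /= -!rows_belowE dominance_rows_eq 1?ltnW //; lia.
Qed.

End Dominance.

Section RowColumn.
Variables (mu la : part n) (x : 'S_n).
Hypothesis inj_rc : forall i j, row_of mu i = row_of mu j ->
  col_of la (x i) = col_of la (x j) -> i = j.

(** The entries in the first [t] rows of [mu] that [x] sends to column [y] of [la]: at most one per
    row by [inj_rc], and at most a whole column. Summing the bound over [y] gives dominance. *)
Let d t y := #|[set i | (row_of mu i < t) && (col_of la (x i) == y)]|.

Let card_col_perm y : #|[set i | col_of la (x i) == y]| = col_len la y.
Proof.
rewrite -card_col -[RHS](card_imset _ (@perm_inj _ x^-1)); apply: eq_card => i.
apply/idP/imsetP; rewrite inE.
  by move=> ix; exists (x i); rewrite ?inE // permK.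
by case=> j; rewrite inE => jy ->; rewrite permKV.
Qed.

Let d_le t y : d t y <= minn t (col_len la y).
Proof.
rewrite leq_min; apply/andP; split; last first.
  by rewrite -card_col_perm; apply/subset_leq_card/subsetP => i; rewrite !inE => /andP[].
case: t => [|t]; first by rewrite leqn0; apply/eqP/eq_card0 => i; rewrite inE.
rewrite /d -[X in _ <= X]card_ord.
rewrite -(card_in_imset (f := fun i => inord (row_of mu i) : 'I_t.+1)) ?max_card //.
move=> i j; rewrite !inE => /andP[it /eqP ci] /andP[jt /eqP cj] /(congr1 val).
by rewrite /= !inordK // => er; apply: inj_rc; rewrite ?ci ?cj.
Qed.

Let rows_d t : rows_below mu t = \sum_(y < n) d t y.
Proof.
rewrite /rows_below (card_split_col _ (fun i => col_of_ltn la (x i))).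
by apply: eq_bigr => y _; apply: eq_card => i; rewrite !inE.
Qed.

Lemma rows_below_le t : rows_below mu t <= rows_below la t.
Proof. by rewrite rows_d rows_below_col; apply: leq_sum => y _; apply: d_le. Qed.

(** Equal weights turn every bound [d_le] into an equality. With [t] the row of [i] and [y] the
    column of [x i], passing from [t] to [t.+1] adds exactly [i] to the set counted by [d], so the
    minimum of [t] and the length of column [y] still grows at [t]: the cell (t, y) lies in [la]. *)
Lemma weight_eq_cell i : weight mu = weight la ->
  col_of la (x i) < nth 0 (parts la) (row_of mu i).
Proof.
move=> ew.
have et (t : 'I_n.+1) : rows_below mu t = rows_below la t.
  by apply: (dominance_rows_eq (fun t _ => rows_below_le t) ew); rewrite -ltnS.
have ed (t : 'I_n.+1) (y : 'I_n) : d t y = minn t (col_len la y).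
  have /leqif_sum := fun (y : 'I_n) (_ : true) => leqif_eq (d_le t y).
  case=> _; rewrite -rows_d -rows_below_col et eqxx.
  by move/esym/forall_inP/(_ y isT)/eqP.
set y := col_of la (x i); set t := row_of mu i.
have tn : t < n := row_of_lt mu i.
have yn : y < n := col_of_ltn la (x i).
have e1 := ed (Ordinal (leqW tn)) (Ordinal yn).
have e2 := ed (@Ordinal n.+1 t.+1 tn) (Ordinal yn).
rewrite /= in e1 e2.
have : d t.+1 y = (d t y).+1.
  rewrite /d (cardsD1 i) inE ltnSn eqxx add1n; congr _.+1.
  apply: eq_card => j; rewrite !inE.
  case: (eqVneq (col_of la (x j)) y) => cj; rewrite ?andbF // !andbT.
  case: (ltngtP (row_of mu j) t) => ej; rewrite ?ltnS ?ej ?leqnn ?andbT ?andbF.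
  - by rewrite ltnW // andbT; apply/eqP=> eij; rewrite eij ltnn in ej.
  - by rewrite leqNgt ej andbF.
  - by rewrite (inj_rc ej cj) eqxx.
by rewrite e1 e2 col_lenP; lia.
Qed.

End RowColumn.

(** [p] moves [i] along its row into the column of [x i], where [weight_eq_cell] provides a cell;
    the remaining factor [p^-1 * x] then preserves columns. *)
Lemma row_colP la (x : 'S_n) :
  (forall i j, row_of la i = row_of la j ->
     col_of la (x i) = col_of la (x j) -> i = j) ->
  exists p q, [/\ p \in row_stab la, q \in col_stab la & x = (p * q)%g].
Proof.
move=> inj_rc; have cellx i := weight_eq_cell inj_rc i erefl.
have ex i : exists j, (row_of la j == row_of la i) && (col_of la j == col_of la (x i)).
  by have [j rj cj] := cell_surj (cellx i); exists j; rewrite rj cj !eqxx.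
pose f i := xchoose (ex i).
have fP i : row_of la (f i) = row_of la i /\ col_of la (f i) = col_of la (x i).
  by have /andP[/eqP er /eqP ec] := xchooseP (ex i).
have finj : injective f.
  move=> i j e; have [ri ci] := fP i; have [rj cj] := fP j.
  by apply: inj_rc; [rewrite -ri -rj e | rewrite -ci -cj e].
exists (perm finj), ((perm finj)^-1 * x)%g; split; last by rewrite mulKVg.
  by rewrite inE; apply/forallP=> i; rewrite permE (fP i).1.
rewrite inE; apply/forallP => i; rewrite permM -(fP _).2.
by rewrite -[f _](permE finj) permKV.
Qed.

Lemma tperm_row_stab la i j : row_of la i = row_of la j ->
  tperm i j \in row_stab la.
Proof.
by move=> e; rewrite inE; apply/forallP=> k; case: tpermP => // ->; rewrite ?e.
Qed.

Lemma tperm_col_stab la i j : col_of la i = col_of la j ->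
  tperm i j \in col_stab la.
Proof.
by move=> e; rewrite inE; apply/forallP=> k; case: tpermP => // ->; rewrite ?e.
Qed.

(* Von Neumann's lemma: either the row and column groups share a transposition
   (up to conjugation by x), or mu is dominated by la. *)
Lemma row_col_cases mu la (x : 'S_n) :
  (exists2 t : 'S_n, t \in row_stab mu & (t ^ x)%g \in col_stab la /\ odd_perm t)
  \/ (weight mu <= weight la /\ (weight mu = weight la -> mu = la /\
     exists p q, [/\ p \in row_stab la, q \in col_stab la & x = (p * q)%g])).
Proof.
case: (boolP [exists i, exists j, [&& i != j, row_of mu i == row_of mu j
         & col_of la (x i) == col_of la (x j)]]).
  case/existsP=> i /existsP[j /and3P[ij /eqP rij /eqP cij]]; left.
  exists (tperm i j); first exact: tperm_row_stab.
  by rewrite tpermJ odd_tperm ij; split=> //; apply: tperm_col_stab.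
move=> nex; right.
have inj_rc i j : row_of mu i = row_of mu j ->
    col_of la (x i) = col_of la (x j) -> i = j.
  move=> er ec; apply/eqP; apply: contraNT nex => ij.
  by apply/existsP; exists i; apply/existsP; exists j; rewrite ij er ec !eqxx.
have dom t (_ : t <= n) := rows_below_le inj_rc t.
split; first exact: dominance_weight dom.
move=> ew; have e := dominance_eq dom ew; split=> //; subst mu.
exact: row_colP.
Qed.

Lemma row_stabM la p q : p \in row_stab la -> q \in row_stab la ->
  (p * q)%g \in row_stab la.
Proof.
rewrite !inE => /forallP hp /forallP hq; apply/forallP => i.
by rewrite permM (eqP (hq _)).
Qed.

Lemma col_stabM la p q : p \in col_stab la -> q \in col_stab la ->
  (p * q)%g \in col_stab la.
Proof.
rewrite !inE => /forallP hp /forallP hq; apply/forallP => i.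
by rewrite permM (eqP (hq _)).
Qed.

Lemma row_stabV la p : (p^-1%g \in row_stab la) = (p \in row_stab la).
Proof.
by rewrite !inE; apply/forallP/forallP => h i; [have := h (p i) | have := h (p^-1 i)%g];
   rewrite ?permK ?permKV eq_sym.
Qed.

Lemma col_stabV la p : (p^-1%g \in col_stab la) = (p \in col_stab la).
Proof.
by rewrite !inE; apply/forallP/forallP => h i; [have := h (p i) | have := h (p^-1 i)%g];
   rewrite ?permK ?permKV eq_sym.
Qed.

Lemma row_stab1 la : 1%g \in row_stab la.
Proof. by rewrite inE; apply/forallP => i; rewrite perm1. Qed.

Lemma col_stab1 la : 1%g \in col_stab la.
Proof. by rewrite inE; apply/forallP => i; rewrite perm1. Qed.

Lemma row_col_stab1 la p : p \in row_stab la -> p \in col_stab la -> p = 1%g.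
Proof.
rewrite !inE => /forallP hp /forallP hq; apply/permP=> i; rewrite perm1.
exact: cell_inj (eqP (hp i)) (eqP (hq i)).
Qed.

End Diagram.

(** * Words *)

Section Words.
Variables (n : nat) (X : finType).
Implicit Types (h : {ffun 'I_n -> X}) (s x : 'S_n).

Definition wcount h y := #|[set i | h i == y]|.
Definition wfix h s := [forall i, h (s i) == h i].
Definition wcomp h x : {ffun 'I_n -> X} := [ffun i => h (x i)].
Definition wclass h0 := [set h | [forall y, wcount h y == wcount h0 y]].
Definition wstab h := [set s | wfix h s].

Lemma wcountE h y : wcount h y = count_mem y [seq h i | i <- enum 'I_n].
Proof.
rewrite /wcount cardE size_filter count_map -!enumT.
by apply: eq_count => i /=; rewrite inE.
Qed.

Lemma wclassP h0 h : reflect (exists x, h = wcomp h0 x) (h \in wclass h0).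
Proof.
apply: (iffP idP) => [|[x ->]].
  rewrite inE => /forallP ec.
  have /tuple_permP[x e] : perm_eq (mktuple h) (mktuple h0).
    by apply/allP=> y _; have := ec y; rewrite !wcountE.
  exists x; apply/ffunP=> i; rewrite ffunE.
  by have /(congr1 (fun t => tnth t i)) := val_inj e; rewrite !tnth_mktuple.
rewrite inE; apply/forallP=> y; apply/eqP.
rewrite /wcount -[LHS](card_imset _ (@perm_inj _ x)); apply: eq_card => i.
apply/imsetP/idP; first by case=> j; rewrite !inE ffunE => hj ->.
by rewrite inE => hi; exists (x^-1 i)%g; rewrite ?inE ?ffunE permKV.
Qed.

(** Orbit-stabilizer: the words of one content form an orbit, and the fibre over [wcomp h0 y] is the
    coset of [y] modulo [wstab h0]. *)
Lemma sum_wcomp h0 (phi : {ffun 'I_n -> X} -> nat) :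
  \sum_x phi (wcomp h0 x) = #|wstab h0| * \sum_(h in wclass h0) phi h.
Proof.
rewrite (partition_big (wcomp h0) (fun h => h \in wclass h0)) /=; last first.
  by move=> x _; apply/wclassP; exists x.
rewrite big_distrr /=; apply: eq_bigr => h /wclassP[y ->].
rewrite (eq_bigr (fun=> phi (wcomp h0 y))) => [|x /eqP-> //].
rewrite sum_nat_const; congr (_ * _); rewrite -[RHS](card_imset _ (mulgI y)).
apply: eq_card => x; transitivity (wcomp h0 x == wcomp h0 y) => //.
apply/eqP/imsetP => [e|[s]].
  exists (y^-1 * x)%g; last by rewrite mulKVg.
  rewrite inE; apply/forallP=> i; rewrite permM; have /ffunP/(_ (y^-1 i)%g) := e.
  by rewrite !ffunE permKV => ->.
by rewrite inE => /forallP fs ->; apply/ffunP=> i; rewrite !ffunE permM (eqP (fs _)).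
Qed.

Lemma wfix_comp h s x : wfix (wcomp h x) s = ((s ^ x)%g \in wstab h).
Proof.
rewrite inE; apply/forallP/forallP => fs i.
  have := fs (x^-1 i)%g; rewrite !ffunE permKV => /eqP <-.
  by rewrite conjgE !permM.
have := fs (x i); rewrite conjgE !permM permK => /eqP e.
by rewrite !ffunE e.
Qed.

Lemma wstab_gt0 h : 0 < #|wstab h|.
Proof.
by apply/card_gt0P; exists 1%g; rewrite inE; apply/forallP => i; rewrite perm1.
Qed.

(** Burnside's lemma for a single orbit. After multiplication by the order of the stabilizer, both
    sides count pairs (s, x) with [s ^ x] in [wstab h0]. *)
Lemma sum_wfix h0 : \sum_(s : 'S_n) #|[set h in wclass h0 | wfix h s]| = n`!.
Proof.
apply/eqP; rewrite -(eqn_pmul2l (wstab_gt0 h0)) big_distrr /=; apply/eqP.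
have E s : #|wstab h0| * #|[set h in wclass h0 | wfix h s]|
    = \sum_x ((s ^ x)%g \in wstab h0).
  rewrite -[X in _ * X]sum1_card (eq_bigl (fun h => (h \in wclass h0) && wfix h s)).
    rewrite big_mkcondr -sum_wcomp; apply: eq_bigr => x _.
    by rewrite wfix_comp; case: (_ \in _).
  by move=> h; rewrite !inE.
rewrite (eq_bigr _ (fun s _ => E s)) exchange_big /=.
rewrite (eq_bigr (fun=> #|wstab h0|)) => [|x _].
  by rewrite sum_nat_const card_Sn mulnC.
rewrite -sum1_card [RHS]big_mkcond /= [RHS](reindex_inj (conjg_inj x)) /=.
by apply: eq_bigr => s _; case: (_ \in _).
Qed.
End Words.

Definition content_words n (alpha : seq nat) : {set {ffun 'I_n -> 'I_(size alpha)}} :=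
  [set h : {ffun 'I_n -> 'I_(size alpha)} | [forall j, wcount h j == nth 0 alpha j]].

(* The permutation character of 'S_n on words of content alpha. *)
Definition word_fix n (alpha : seq nat) (s : 'S_n) :=
  #|[set h in content_words n alpha | wfix h s]|.


Section WordsRev.
Variables (n : nat) (a : seq nat).

Let rv (i : 'I_(size a)) : 'I_(size (rev a)) := cast_ord (esym (size_rev a)) (rev_ord i).

Let rv_bij : bijective rv.
Proof.
exists (fun i => rev_ord (cast_ord (size_rev a) i)) => i.
  by rewrite /rv cast_ordKV rev_ordK.
by rewrite /rv rev_ordK cast_ordK.
Qed.

(** [nchains] reads a content from its largest letter, so matrix counts arise with reversed margins;
    renaming the letters undoes the reversal on words. *)
Lemma word_fix_rev s : @word_fix n (rev a) s = word_fix a s.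
Proof.
have rv_inj := bij_inj rv_bij; have [rv' rvK rv'K] := rv_bij.
pose f (h : {ffun 'I_n -> 'I_(size a)}) := [ffun i => rv (h i)].
have fc h i : wcount (f h) (rv i) = wcount h i.
  by apply: eq_card => x; rewrite !inE ffunE (inj_eq rv_inj).
have nrv i : nth 0 (rev a) (rv i) = nth 0 a i.
  rewrite nth_rev /= ?subnS; last by have := ltn_ord i; lia.
  by congr nth; have := ltn_ord i; lia.
rewrite /word_fix -[RHS](card_imset _ (f := f)); last first.
  by move=> h h' /ffunP e; apply/ffunP => i; apply: rv_inj; have := e i; rewrite !ffunE.
apply: eq_card => g; apply/idP/imsetP => [|[h]].
  rewrite !inE => /andP[/forallP gc /forallP gs].
  have e : g = f [ffun i => rv' (g i)] by apply/ffunP=> i; rewrite !ffunE rv'K.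
  exists [ffun i => rv' (g i)] => //; rewrite !inE; apply/andP; split.
    by apply/forallP=> i; rewrite -fc -e -nrv gc.
  by apply/forallP=> i; rewrite !ffunE (eqP (gs i)).
rewrite !inE => /andP[/forallP hc /forallP hs] ->; apply/andP; split.
  by apply/forallP=> i; rewrite -(rv'K i) fc nrv hc.
by apply/forallP=> i; rewrite !ffunE (eqP (hs i)).
Qed.

End WordsRev.

(** * Horizontal strips and the Kostka recursion *)

Section Rows.
Variable n : nat.
(** Shapes are arbitrary tuples of row lengths, so sums over them carry no side condition;
    interlacing already forces weak decrease, and [nchains] vanishes on all other tuples. *)
Definition rows := n.-tuple 'I_n.+1.
Implicit Types l m : rows.

Definition rowv l i := nth 0 [seq nat_of_ord x | x <- l] i.
Definition mk_rows (f : nat -> nat) : rows := mktuple (fun i => inord (f i)).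
Definition sz l := \sum_(i < n) rowv l i.

Lemma rowv_tnth l (i : 'I_n) : rowv l i = tnth l i.
Proof.
rewrite /rowv (nth_map ord0) ?size_tuple //; congr nat_of_ord.
by rewrite (tnth_nth ord0).
Qed.

Lemma rowv_default l i : n <= i -> rowv l i = 0.
Proof. by move=> h; rewrite /rowv nth_default // size_map size_tuple. Qed.

Lemma rowv_mk f i : i < n -> f i <= n -> rowv (mk_rows f) i = f i.
Proof.
by move=> ltin fi; rewrite -[ i ]/(val (Ordinal ltin)) rowv_tnth tnth_mktuple /= inordK.
Qed.

Lemma rowv_inj l m : (forall i, i < n -> rowv l i = rowv m i) -> l = m.
Proof.
by move=> e; apply: eq_from_tnth => i; apply: val_inj; rewrite /= -!rowv_tnth e.
Qed.

Lemma rowv_le l i : rowv l i <= n.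
Proof.
case: (ltnP i n) => h; last by rewrite rowv_default.
by rewrite -[ i ]/(val (Ordinal h)) rowv_tnth -ltnS.
Qed.

Lemma rowv_le_sz l i : rowv l i <= sz l.
Proof.
case: (ltnP i n) => h; last by rewrite rowv_default.
by rewrite /sz (bigD1 (Ordinal h)) //= leq_addr.
Qed.

Lemma sz_eq0 l i : sz l = 0 -> rowv l i = 0.
Proof. by have := rowv_le_sz l i; lia. Qed.

(** The interlacing form of the condition that [l] / [m] has at most one cell in each column. *)
Definition hstrip l m :=
  [forall i : 'I_n, (rowv m i <= rowv l i) && (rowv l i.+1 <= rowv m i)].

Lemma hstripP l m : reflect (forall i, rowv m i <= rowv l i /\ rowv l i.+1 <= rowv m i)
  (hstrip l m).
Proof.
apply: (iffP forallP) => [h i|h i]; last by apply/andP.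
case: (ltnP i n) => lti; first by have /andP := h (Ordinal lti).
by rewrite !rowv_default //; lia.
Qed.

Lemma hstrip_sz l m : hstrip l m -> sz m <= sz l.
Proof. by move/hstripP=> h; apply: leq_sum => i _; have [] := h i. Qed.

Lemma sum_shift (f : nat -> nat) : (\sum_(i < n) f i.+1) + f 0 = (\sum_(i < n) f i) + f n.
Proof.
transitivity (\sum_(i < n.+1) f i); last exact: big_ord_recr.
by rewrite big_ord_recl addnC.
Qed.

Section Commutation.
Variables (r t : rows) (s : nat).
(** [tlast] makes the reflection interval past the last row degenerate, so a common upper bound fits
    into [n] rows; [sn] keeps its first row at most [n]. *)
Hypotheses (n_gt0 : 0 < n) (tlast : rowv t n.-1 = 0) (sn : s <= n).

Let mn i := minn (rowv r i) (rowv t i).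
Let mx i := maxn (rowv r i) (rowv t i).

Let up := [set l | [&& hstrip l r, hstrip l t & sz l == s]].
(** The size condition comes from summing [m_i + l_(i+1) = mn i + mx (i+1)] over the rows: the first
    row of [l] is left out of the reflection and contributes its excess [j = l_0 - mx 0]. *)
Let down := [set jm : 'I_n.+1 * rows |
  [&& hstrip r jm.2, hstrip t jm.2 & sz jm.2 + s == sz r + sz t + jm.1]].

Let sum_mnx : \sum_(i < n) mn i + \sum_(i < n) mx i = sz r + sz t.
Proof.
rewrite /sz -!big_split /=; apply: eq_bigr => i _.
by rewrite /mn /mx; lia.
Qed.

Let bounds_up l : l \in up -> [/\ sz l = s, forall i, mx i <= rowv l i
  & forall i, rowv l i.+1 <= mn i].
Proof.
rewrite inE /= => /and3P[/hstripP hr /hstripP ht /eqP ->]; split=> // i;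
  have := hr i; have := ht i; rewrite /mn /mx; lia.
Qed.

Let bounds_down j m : (j, m) \in down -> [/\ sz m + s = sz r + sz t + j,
  forall i, rowv m i <= mn i & forall i, mx i.+1 <= rowv m i].
Proof.
rewrite inE /= => /and3P[/hstripP hr /hstripP ht /eqP ->]; split=> // i;
  have := hr i; have := ht i; rewrite /mn /mx; lia.
Qed.

(* The local rule: the rows of an upper bound l below the first are reflected
   in the intervals [mx i.+1, mn i], and the excess of the first row of l over
   its minimum mx 0 is recorded separately. *)
Let toD l : 'I_n.+1 * rows :=
  (inord (rowv l 0 - mx 0), mk_rows (fun i => mn i + mx i.+1 - rowv l i.+1)).

Let toU_fun (jm : 'I_n.+1 * rows) i :=
  if i is i'.+1 then mn i' + mx i - rowv jm.2 i' else mx 0 + jm.1.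
Let toU jm := mk_rows (toU_fun jm).

Let mn_le i : mn i <= n.
Proof. by rewrite /mn; have := rowv_le r i; lia. Qed.

Let mn_last i : n <= i.+1 -> mn i = 0.
Proof.
move=> h; rewrite /mn; case: (ltnP i n) => h2; last by rewrite !rowv_default.
by rewrite (_ : i = n.-1) ?tlast ?minn0 //; lia.
Qed.

Let mx_n i : n <= i -> mx i = 0.
Proof. by move=> h; rewrite /mx !rowv_default. Qed.

Let rowv_toD l i : l \in up ->
  rowv (toD l).2 i = mn i + mx i.+1 - rowv l i.+1.
Proof.
move=> lu; have [_ h1 h2] := bounds_up lu.
case: (ltnP i n) => lti.
  by rewrite rowv_mk //; have := h1 i.+1; have := mn_le i; lia.
by rewrite mn_last ?mx_n ?rowv_default //; lia.
Qed.

Let rowv_toD0 l : l \in up -> (toD l).1 = rowv l 0 - mx 0 :> nat.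
Proof. by move=> lu; rewrite inordK //; have := rowv_le l 0; lia. Qed.

Let toU_bound jm : jm \in down -> mx 0 + jm.1 <= n.
Proof.
case: jm => j m /bounds_down[e h1 h2] /=.
have : sz m <= \sum_(i < n) mn i by apply: leq_sum => i _.
have : mx 0 <= \sum_(i < n) mx i by rewrite (bigD1 (Ordinal n_gt0)) //= leq_addr.
by lia.
Qed.

Let rowv_toU jm i : jm \in down -> rowv (toU jm) i = toU_fun jm i.
Proof.
move=> jd; have := toU_bound jd; case: jm jd => j m jd /= b.
have [e h1 h2] := bounds_down jd.
case: (ltnP i n) => lti.
  rewrite rowv_mk //; case: i lti => [|i] lti //=.
  by have := h2 i; have := mn_le i; lia.
rewrite rowv_default //; case: i lti => [|i] lti /=; first lia.
by rewrite mn_last // mx_n.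
Qed.

Let sz_toD l : l \in up -> sz (toD l).2 + s = sz r + sz t + (toD l).1.
Proof.
move=> lu; have [e h1 h2] := bounds_up lu; rewrite rowv_toD0 // -e.
have E1 : sz (toD l).2 + \sum_(i < n) rowv l i.+1 = \sum_(i < n) mn i + \sum_(i <
  n) mx i.+1.
  rewrite /sz -!big_split /=; apply: eq_bigr => i _; rewrite rowv_toD //.
  by have := h2 i; lia.
have := sum_shift (rowv l); have := sum_shift mx.
rewrite (rowv_default _ (leqnn n)) (mx_n (leqnn n)) -/(sz l).
by have := h1 0; have := sum_mnx; lia.
Qed.

Let sz_toU jm : jm \in down -> sz (toU jm) = s.
Proof.
case: jm => j m jd; have [e h1 h2] := bounds_down jd.
have E1 : sz m + \sum_(i < n) rowv (toU (j, m)) i.+1 = \sum_(i < n) mn i +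
  \sum_(i < n) mx i.+1.
  rewrite /sz -!big_split /=; apply: eq_bigr => i _; rewrite rowv_toU //=.
  by have := h1 i; lia.
have := sum_shift (rowv (toU (j, m))); have := sum_shift mx.
have e0 : rowv (toU (j, m)) 0 = mx 0 + j by rewrite rowv_toU.
rewrite (rowv_default _ (leqnn n)) (mx_n (leqnn n)) -/(sz _) e0.
by have := sum_mnx; lia.
Qed.

Let toD_down l : l \in up -> toD l \in down.
Proof.
move=> lu; have [e h1 h2] := bounds_up lu; rewrite inE; apply/and3P; split.
- apply/hstripP => i; rewrite rowv_toD //; have := h2 i; have := h1 i.+1.
  by rewrite /mn /mx; lia.
- apply/hstripP => i; rewrite rowv_toD //; have := h2 i; have := h1 i.+1.
  by rewrite /mn /mx; lia.
- by rewrite sz_toD.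
Qed.

Let toU_up jm : jm \in down -> toU jm \in up.
Proof.
case: jm => j m jd; have [e h1 h2] := bounds_down jd.
rewrite inE; apply/and3P; split; last by rewrite sz_toU.
- apply/hstripP => i; rewrite !rowv_toU //=; case: i => [|i] /=.
    by have := h2 0; rewrite /mn /mx; lia.
  by have := h1 i; have := h2 i.+1; rewrite /mn /mx; lia.
- apply/hstripP => i; rewrite !rowv_toU //=; case: i => [|i] /=.
    by have := h2 0; rewrite /mn /mx; lia.
  by have := h1 i; have := h2 i.+1; rewrite /mn /mx; lia.
Qed.

(** This is the commutation relation between adding and removing horizontal strips; [j] plays the
    part of the exponent in the geometric series of 1/(1 - xy). *)
Lemma card_hstrip_comm : #|up| = #|down|.
Proof.
have upK l : l \in up -> toU (toD l) = l.
  move=> lu; have [e h1 h2] := bounds_up lu; apply: rowv_inj => i _.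
  rewrite rowv_toU ?toD_down //; case: i => [|i].
    by rewrite [toU_fun _ _]/= rowv_toD0 //; have := h1 0; lia.
  rewrite [toU_fun _ _]/= rowv_toD //; have := h1 i.+1; have := h2 i; lia.
have downK jm : jm \in down -> toD (toU jm) = jm.
  case: jm => j m jd; have [e h1 h2] := bounds_down jd; congr (_, _).
    apply: val_inj; rewrite /= -[LHS]/(nat_of_ord (toD (toU (j, m))).1).
    by rewrite rowv_toD0 ?toU_up // rowv_toU //= addKn.
  apply: rowv_inj => i _; rewrite -[mk_rows _]/(toD (toU (j, m))).2.
  by rewrite rowv_toD ?toU_up // rowv_toU //=; have := h1 i; have := h2 i; lia.
rewrite -(card_in_imset (f := toD)) => [|l l' lu lu' e]; last first.
  by rewrite -(upK l) // -(upK l') // e.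
apply: eq_card => jm; apply/imsetP/idP => [[l lu ->]|jd]; first exact: toD_down.
by exists (toU jm); rewrite ?toU_up // downK.
Qed.

End Commutation.

(* Chains of shapes from l down to 0 with horizontal strip steps; the content b
   lists the multiplicity of the largest letter first. *)
Fixpoint nchains l (b : seq nat) : nat :=
  if b is a :: b' then \sum_(m | hstrip l m && (sz l == sz m + a)) nchains m b'
  else sz l == 0.

Lemma nchains_sz l b : nchains l b != 0 -> sz l = sumn b.
Proof.
elim: b l => [|a b IH] l /=; first by case: (eqVneq (sz l) 0).
rewrite sum_nat_eq0 negb_forall => /existsP[m].
by rewrite negb_imply => /andP[/andP[_ /eqP ->] /IH ->]; rewrite addnC.
Qed.

Lemma nchains_rows l b i : nchains l b != 0 -> size b <= i -> rowv l i = 0.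
Proof.
elim: b l i => [|a b IH] l i /=; first by case: (eqVneq (sz l) 0) => // e _ _;
  apply: sz_eq0.
rewrite sum_nat_eq0 negb_forall => /existsP[m].
rewrite negb_imply => /andP[/andP[/hstripP h _] /IH IHm].
by case: i => // i /IHm mi; have := h i; rewrite mi; lia.
Qed.

(* The sum of [Phi (b - v)] over all [v <= b] with sum [a]. *)
Fixpoint removals a b (Phi : seq nat -> nat) : nat :=
  if b is c :: b' then
    \sum_(j < a.+1 | j <= c) removals (a - j) b' (fun b2 => Phi (c - j :: b2))
  else if a == 0 then Phi [::] else 0.

Lemma removals_sum I (r : seq I) (P : pred I) a b (Phi : I -> seq nat -> nat) :
  removals a b (fun b' => \sum_(i <- r | P i) Phi i b')
    = \sum_(i <- r | P i) removals a b (Phi i).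
Proof.
elim: b a Phi => [|c b IH] a Phi /=; first by case: eqP => // _; rewrite big1.
rewrite exchange_big /=; apply: eq_bigr => j _; exact: IH.
Qed.

Lemma removals_mull k a b (Phi : seq nat -> nat) :
  removals a b (fun b' => k * Phi b') = k * removals a b Phi.
Proof.
elim: b a Phi => [|c b IH] a Phi /=; first by case: eqP => // _; rewrite muln0.
by rewrite big_distrr /=; apply: eq_bigr => j _; apply: IH.
Qed.

Lemma eq_removals a b (Phi Psi : seq nat -> nat) :
  (forall b', size b' = size b -> Phi b' = Psi b') -> removals a b Phi = removals a b Psi.
Proof.
elim: b a Phi Psi => [|c b IH] a Phi Psi e /=; first by case: eqP => // _; apply: e.
by apply: eq_bigr => j _; apply: IH => b' sb; apply: e; rewrite /= sb.
Qed.

Lemma removals_ord N a c b (Phi : nat -> seq nat -> nat) : a < N ->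
  \sum_(j < a.+1 | j <= c) removals (a - j) b (Phi j)
  = \sum_(j < N | (j <= c) && (j <= a)) removals (a - j) b (Phi j).
Proof.
move=> aN; rewrite (big_ord_widen_cond N (fun j => j <= c) (fun j => removals (a
  - j) b (Phi j))) //.
Qed.

(* Adding a horizontal strip is adjoint to removing letters from the content. *)
Lemma sum_hstrip_nchains b a r : size b <= n -> sz r + a <= n ->
  \sum_(l | hstrip l r && (sz l == sz r + a)) nchains l b
    = removals a b (nchains r).
Proof.
elim: b a r => [|c b IH] a r /= sb an.
  case: (eqVneq a 0) => [->|a0]; last by rewrite big1 // => l /andP[_ /eqP->];
    case: eqP => //; lia.
  rewrite addn0; case: (eqVneq (sz r) 0) => [r0|r0]; last first.
    by rewrite big1 // => l /andP[_ /eqP->]; rewrite (negbTE r0).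
  rewrite (bigD1 r) /=; last first.
    by rewrite r0 eqxx andbT; apply/hstripP => i; rewrite !sz_eq0.
  rewrite r0 eqxx big1 // => l /andP[/andP[_ /eqP l0] /eqP []].
  by apply: rowv_inj => i _; rewrite !sz_eq0.
have n0 : 0 < n by lia.
(* The growth rule trades the common upper bound [l] of [r] and [m] for a common lower bound [q] and
   a number [j], which becomes the number of copies of the first letter that are removed. *)
have L : \sum_(l | hstrip l r && (sz l == sz r + a))
      \sum_(m | hstrip l m && (sz l == sz m + c)) nchains m b
   = \sum_m \sum_(j < n.+1) \sum_(q | [&& hstrip r q, hstrip m q,
       sz r + a == sz m + c & sz q + a == sz m + j]) nchains m b.
  rewrite (exchange_big_dep predT) //=; apply: eq_bigr => m _.
  case: (eqVneq (nchains m b) 0) => [->|m0].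
    by rewrite big1 //; apply/esym/big1 => j _; apply: big1.
  (* A chain with content [b] uses at most [size b < n] rows; this supplies [tlast]. *)
  have ml : rowv m n.-1 = 0 by apply: nchains_rows m0 _; lia.
  case: (eqVneq (sz r + a) (sz m + c)) => [e|ne]; last first.
    rewrite big_pred0; first by rewrite big1 // => j _; rewrite big_pred0 // =>
      q; rewrite /= !andbF.
    move=> l; apply/negP => /andP[/andP[_ /eqP e1] /andP[_ /eqP e2]].
    by move/eqP: ne; lia.
  have := card_hstrip_comm r (s := sz r + a) n0 ml an.
  set up := [set l | _]; set down := [set jm | _] => ud.
  transitivity (\sum_(l in up) nchains m b).
    apply: eq_bigl => l; rewrite inE -e.
    by case: (hstrip l r); case: (hstrip l m); case: eqP.
  rewrite sum_nat_const ud -sum_nat_const.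
  rewrite pair_big_dep /=; apply: eq_big => [[j q]|//]; rewrite inE /=.
  by case: (hstrip r q); case: (hstrip m q) => //=; apply/eqP/eqP; lia.
rewrite L exchange_big /= (removals_ord c b (fun j b2 => nchains r (c - j :: b2))
  (N := n.+1)); last by lia.
rewrite [RHS]big_mkcond; apply: eq_bigr => j _.
case: ifP => [/andP[jc ja]|nj]; last first.
  apply: big1 => m _; apply: big_pred0 => q; apply/negP => /and4P[h1 h2 /eqP e1 /eqP e2].
  by have := hstrip_sz h1; have := hstrip_sz h2; move: nj; lia.
rewrite /= removals_sum.
rewrite (exchange_big_dep (fun q => hstrip r q && (sz r == sz q + (c - j)))) /=;
  last first.
  by move=> m q _ /and4P[-> h2 /eqP e1 /eqP e2]; apply/eqP; lia.
apply: eq_bigr => q /andP[rq /eqP eq].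
rewrite -IH; [|lia|]; last by have := hstrip_sz rq; lia.
apply: eq_bigl => m; rewrite rq /=; case: (boolP (hstrip m q)) => //= mq.
by apply/andP/eqP => [[/eqP e1 /eqP e2]|e]; [lia | split; apply/eqP; lia].
Qed.

(** The number of matrices over the natural numbers with row sums [a] and column sums [b], peeling
    off one row at a time. *)
Fixpoint nmats (a b : seq nat) : nat :=
  if a is c :: a' then removals c b (nmats a') else (sumn b == 0).

Definition rows0 : rows := mk_rows (fun=> 0).

Lemma rowv0 i : rowv rows0 i = 0.
Proof.
case: (ltnP i n) => h; last by rewrite rowv_default.
by rewrite /rows0 (rowv_mk (f := fun=> 0)).
Qed.

Lemma sz0 : sz rows0 = 0.
Proof. by rewrite /sz big1 // => i _; rewrite rowv0. Qed.

Lemma sz_eq0P l : (sz l == 0) = (l == rows0).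
Proof.
apply/eqP/eqP => [h|->]; last exact: sz0.
by apply: rowv_inj => i _; rewrite rowv0 sz_eq0.
Qed.

Lemma nchains0 b : nchains rows0 b = (sumn b == 0).
Proof.
case: (eqVneq (sumn b) 0) => [|b0]; last first.
  apply/eqP; apply: contraNT b0 => h.
  by rewrite -(nchains_sz (h : nchains rows0 b != 0)) sz0.
elim: b => [|a b IH] /=; first by rewrite sz0.
move/eqP; rewrite addn_eq0 => /andP[/eqP a0 /eqP b0].
rewrite (bigD1 rows0) /=; last first.
  by rewrite a0 addn0 eqxx andbT; apply/hstripP => i; rewrite !rowv0.
rewrite IH // big1 // => m /andP[/andP[h _]].
by rewrite -sz_eq0P; have := hstrip_sz h; rewrite sz0; lia.
Qed.

(** Adjointness moves the outermost strip of the chain for [a] to the other factor, where it removes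
    one matrix row from the column sums [b]. *)
Theorem sum_nchains2 a b : size b <= n -> sumn a <= n ->
  \sum_l nchains l a * nchains l b = nmats a b.
Proof.
elim: a b => [|c a IH] b sb sa /=.
  rewrite (bigD1 rows0) //= sz0 mul1n nchains0 big1 ?addn0 // => l.
  by rewrite -sz_eq0P => /negbTE ->.
transitivity (removals c b (fun b' => \sum_l nchains l a * nchains l b')); last first.
  by apply: eq_removals => b' sb'; apply: IH; [rewrite sb' | move: sa => /=; lia].
rewrite removals_sum.
under eq_bigr => l _ do rewrite big_distrl.
rewrite (exchange_big_dep predT) //=; apply: eq_bigr => m _.
rewrite removals_mull; case: (eqVneq (nchains m a) 0) => [e|m0].
  by rewrite big1 // e.
rewrite -big_distrr /= sum_hstrip_nchains //.
by rewrite (nchains_sz m0); move: sa => /=; lia.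
Qed.

End Rows.

(** * Unitriangularity of chain counts for dominance *)

Section Triangular.
Variable n : nat.
Implicit Types (l m : rows n) (la nu : part n).

Definition gelfand_tsetlin la b := nchains (val la) (rev b).

Lemma rowv_part la i : rowv (val la) i = nth 0 (parts la) i.
Proof. by []. Qed.

Lemma parts_nonincr la i : nth 0 (parts la) i.+1 <= nth 0 (parts la) i.
Proof.
case: (ltnP i.+1 (size (parts la))) => h; last by rewrite nth_default.
by have /(sortedP 0)/(_ i h) := sorted_parts la.
Qed.

Lemma nchains_sorted l b i : nchains l b != 0 -> rowv l i.+1 <= rowv l i.
Proof.
case: b => [|a b] /=.
  by case: (eqVneq (sz l) 0) => // e _; rewrite !sz_eq0.
rewrite sum_nat_eq0 negb_forall => /existsP[m].
rewrite negb_imply => /andP[/andP[/hstripP h _] _].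
by have := h i; lia.
Qed.

Lemma sz_sumn l : sz l = sumn [seq nat_of_ord i | i <- l].
Proof.
rewrite sumnE big_map (big_nth ord0) size_tuple big_mkord.
by apply: eq_bigr => i _; rewrite rowv_tnth (tnth_nth ord0).
Qed.

Lemma nchains_part l b : nchains l b != 0 -> sumn b = n -> is_partition l.
Proof.
move=> l0 sb; apply/andP; split; last by rewrite -sz_sumn (nchains_sz l0) sb.
apply/(sortedP 0) => i _; exact: (nchains_sorted i l0).
Qed.

Lemma sum_nchains_part (F : rows n -> nat) b : sumn b = n ->
  \sum_l F l * nchains l b = \sum_(la : part n) F (val la) * nchains (val la) b.
Proof.
move=> sb; rewrite (bigID (@is_partition n)) /= [X in _ + X]big1 ?addn0; last first.
  move=> l; apply: contraNeq; rewrite muln_eq0 negb_or => /andP[_ l0].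
  exact: nchains_part l0 sb.
rewrite (reindex_omap (val : part n -> rows n) insub) /=; last first.
  by move=> l lp; rewrite insubT.
by apply: eq_bigl => la; rewrite (valP la) valK eqxx.
Qed.

(** In terms of tableaux, the [i] smallest letters lie in the first [i] rows. When [i] counts all
    letters this is a statement on the size of [l]; otherwise the outermost strip is dropped. *)
Lemma nchains_dominance l b i : nchains l b != 0 -> i <= size b ->
  \sum_(j < i) nth 0 (rev b) j <= \sum_(j < i) rowv l j.
Proof.
elim: b l i => [|a b IH] l i l0 /=; first by rewrite leqn0 => /eqP->; rewrite !big_ord0.
rewrite leq_eqVlt => /orP[/eqP ->|].
  have -> : \sum_(j < (size b).+1) nth 0 (rev (a :: b)) j = sumn (rev (a :: b)).
    by rewrite sumnE (big_nth 0) size_rev big_mkord.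
  rewrite sumn_rev -(nchains_sz l0).
  rewrite /sz; case: (leqP n (size b).+1) => h.
    rewrite (big_ord_widen _ (rowv l) h) big_mkcond /=; apply: leq_sum => j _.
    by case: ifP.
  rewrite (bigID (fun j : 'I_n => j < (size b).+1)) /= [X in _ + X]big1 ?addn0.
    by rewrite (big_ord_widen n (rowv l) (ltnW h)).
  by move=> j; rewrite -leqNgt => hj; apply: nchains_rows l0 _.
rewrite ltnS => ib; move: l0 => /=.
rewrite sum_nat_eq0 negb_forall => /existsP[m].
rewrite negb_imply => /andP[/andP[/hstripP h _] m0].
apply: (leq_trans (n := \sum_(j < i) rowv m j)); last first.
  by apply: leq_sum => j _; have [] := h j.
apply: leq_trans (IH m i m0 ib); apply: leq_sum => j _.
by rewrite rev_cons nth_rcons size_rev (leq_trans (ltn_ord j) ib).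
Qed.

Lemma gelfand_tsetlin_dominance la nu t : gelfand_tsetlin la (parts nu) != 0 ->
  t <= n -> rows_below nu t <= rows_below la t.
Proof.
move=> l0 tn; rewrite !rows_belowE.
have := @nchains_dominance (val la) (rev (parts nu)) t l0.
by rewrite revK size_rev size_parts => /(_ tn).
Qed.

Lemma gelfand_tsetlin_eq0 la nu : (weight la <= weight nu) -> la != nu ->
  gelfand_tsetlin la (parts nu) = 0.
Proof.
move=> lew; apply: contraNeq => l0; have dom := gelfand_tsetlin_dominance l0.
rewrite (dominance_eq (mu := nu) (la := la)) //.
by apply/eqP; rewrite eqn_leq lew dominance_weight.
Qed.

Lemma gelfand_tsetlin_diag nu : gelfand_tsetlin nu (parts nu) = 1.
Proof.
(* Stage [i] of the only chain consists of the first [i] rows of [nu]: letter [i] fills row [i]. The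
   existential keeps [f] opaque to simplification. *)
have [f fE] : {f : nat -> nat -> nat &
    forall i j, f i j = if j < i then nth 0 (parts nu) j else 0}.
  by eexists.
have fn i j : f i j <= n by rewrite fE; case: ifP => // _; apply: parts_le.
have rf i j : i <= n -> rowv (mk_rows n (f i)) j = f i j.
  move=> lein; case: (ltnP j n) => jn; first by rewrite rowv_mk.
  by rewrite rowv_default // fE; case: ltnP => //; lia.
have szf i : i < n -> sz (mk_rows n (f i.+1)) = sz (mk_rows n (f i)) + nth 0 (parts nu) i.
  move=> ltin; have lein := ltnW ltin.
  rewrite /sz (bigD1 (Ordinal ltin)) //= rf // fE ltnSn addnC.
  rewrite [in RHS](bigD1 (Ordinal ltin)) //= (rf i) // fE ltnn add0n.
  congr (_ + _); apply: eq_bigr => j /eqP ji; rewrite !rf // !fE.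
  case: (ltngtP (j : nat) i) => [h|h|h]; rewrite ?ltnS ?(ltnW h) //.
    by rewrite leqNgt h.
  by case: ji; apply: val_inj.
have main i : i <= n -> nchains (mk_rows n (f i)) (rev (take i (parts nu))) = 1.
  elim: i => [|i IH] ltin.
    rewrite take0 /= (_ : sz _ = 0) //; apply: big1 => j _; rewrite rf //.
  have lein := ltnW ltin.
  rewrite (take_nth 0) ?size_parts // rev_rcons /=.
  rewrite (bigD1 (mk_rows n (f i))) /=; last first.
    rewrite szf // eqxx andbT; apply/hstripP => j; rewrite !rf // !fE.
    split; first by case: (ltnP j i) => ji //; rewrite ifT //; lia.
    by rewrite ltnS; case: (ltnP j i) => // h; apply: parts_nonincr.
  rewrite IH // big1 ?addn0 // => m /andP[/andP[/hstripP h /eqP e] /eqP ne].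
  apply/eqP; apply: contra_notT ne => m0.
  have {}e : sz m = sz (mk_rows n (f i)) by move: e; rewrite szf //; lia.
  (* A competing [m] has at most [i] rows and lies inside the current shape, hence inside stage [i];
     equal sizes then force equality. *)
  have mle (j : 'I_n) : rowv m j <= rowv (mk_rows n (f i)) j.
    rewrite rf // !fE; case: (ltnP j i) => ji; last first.
      by rewrite (nchains_rows m0) // size_rev size_takel // size_parts.
    by have [] := h j; rewrite rf // fE ifT //; lia.
  apply/rowv_inj => j jn; have /leqif_sum := fun (j : 'I_n) (_ : true) =>
    leqif_eq (mle j).
  case=> _; rewrite -/(sz _) -/(sz _) e eqxx.
  by move/esym/forall_inP/(_ (Ordinal jn) isT)/eqP.
have := main n (leqnn n); rewrite take_oversize ?size_parts // => <-.
congr nchains; apply: rowv_inj => i ltin; rewrite rf // fE ltin.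
exact: rowv_part.
Qed.

End Triangular.

(** * Semistandard tableaux *)

Section Tableaux.
Variables (n : nat) (mu : seq nat).
Let N := size mu.
Notation grid := ('I_n * 'I_n)%type.
Implicit Types (l m : rows n) (t : {ffun grid -> 'I_N.+1}) (c d : grid).

Definition in_rows l c := c.2 < rowv l c.1.

Lemma card_in_rows l : #|[set c | in_rows l c]| = sz l.
Proof.
rewrite -sum1_card (eq_bigl (fun c => true && (c.2 < rowv l c.1))); last first.
  by move=> c; rewrite inE.
rewrite -(pair_big_dep predT (fun (i j : 'I_n) => j < rowv l i) (fun _ _ => 1)) /=.
apply: eq_bigr => i _; rewrite -(big_ord_widen n (fun=> 1) (rowv_le l i)).
by rewrite sum1_card card_ord.
Qed.

Definition row_weak t := [forall c : grid, forall d : grid, (c.1 == d.1) && (c.2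
  <= d.2) ==> (t c <= t d)].

(* Cells outside the shape carry the value [N]. *)
Definition tableau l r : {set {ffun grid -> 'I_N.+1}} :=
  [set t | [&& row_weak t,
    [forall c : grid, forall d : grid, (c.2 == d.2) && (c.1 < d.1) ==> (t c < t
      d) || (t d == N :> nat)],
    [forall c : grid, if in_rows l c then t c < r else t c == N :> nat]
  & [forall j : 'I_N, (j < r) ==> (#|[set c | t c == j :> nat]| == nth 0 mu j)]]].

Lemma tableauP l r t : reflect [/\ forall c d, c.1 = d.1 -> c.2 <= d.2 -> t c <= t d,
   forall c d, c.2 = d.2 -> c.1 < d.1 -> t d < N -> t c < t d,
   (forall c, in_rows l c -> t c < r) /\ (forall c, ~~ in_rows l c -> t c = N :> nat)
   & forall j, j < r -> j < N -> #|[set c | t c == j :> nat]| = nth 0 mu j]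
  (t \in tableau l r).
Proof.
rewrite inE; apply: (iffP and4P) => [[h1 h2 h3 h4]|[h1 h2 [h3 h3'] h4]]; split.
- by move=> c d e le; have /forallP/(_ c)/forallP/(_ d) := h1; rewrite e eqxx le.
- move=> c d e lt; have /forallP/(_ c)/forallP/(_ d) := h2; rewrite e eqxx lt /=.
  by case/orP=> // /eqP ->; rewrite ltnn.
- split=> c hc; have /forallP/(_ c) := h3; first by rewrite hc.
  by rewrite (negbTE hc) => /eqP.
- by move=> j jr jN; have /forallP/(_ (Ordinal jN)) := h4; rewrite /= jr => /eqP.
- apply/forallP=> c; apply/forallP=> d; apply/implyP=> /andP[/eqP e le]; exact: h1.
- apply/forallP=> c; apply/forallP=> d; apply/implyP=> /andP[/eqP e lt].
  case: (eqVneq (t d : nat) N) => [|ne]; first by rewrite orbT.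
  by rewrite (h2 c d) //; have := ltn_ord (t d); lia.
- by apply/forallP=> c; case: (boolP (in_rows l c)) => [/h3|/h3' ->] //.
- by apply/forallP=> j; apply/implyP=> jr; rewrite h4.
Qed.

(** [mk_rows] takes a function on natural numbers; the existential converts its argument to a row
    index. *)
Definition cells_below t q : rows n :=
  mk_rows n (fun i => #|[set j : 'I_n | [exists i' : 'I_n, (i == i' :> nat) && (t
    (i', j) < q)]]|).

(** Entries below [q] form an initial segment of each weakly increasing row, so their number
    determines their positions. *)
Lemma in_cells_below t q c : (forall c d, c.1 = d.1 -> c.2 <= d.2 -> t c <= t d) ->
  in_rows (cells_below t q) c = (t c < q).
Proof.
move=> tw; case: c => i j; rewrite /in_rows /=.
set A := [set j : 'I_n | t (i, j) < q].
have EA : [set j : 'I_n | [exists i' : 'I_n, (i == i' :> nat) && (t (i', j) < q)]] = A.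
  apply/setP=> k; rewrite !inE; apply/existsP/idP => [[i' /andP[/eqP e]]|h].
    by rewrite (val_inj e : i = i').
  by exists i; rewrite eqxx.
rewrite /cells_below rowv_mk // EA; last by rewrite -[X in _ <= X]card_ord max_card.
have down (k k' : 'I_n) : k <= k' -> k' \in A -> k \in A.
  by rewrite !inE => kk; apply: leq_ltn_trans; apply: tw.
apply/idP/idP => [|ja].
  apply: contraTT => na; rewrite -leqNgt.
  have : A \subset [set k : 'I_n | k < j].
    apply/subsetP=> k kA; rewrite inE ltnNge; apply: contra na => jk.
    by have := down _ _ jk kA; rewrite inE.
  move/subset_leq_card/leq_trans; apply.
  by rewrite -sum1_card (eq_bigl (fun k : 'I_n => k < j)) => [|k];
    rewrite ?inE // -(big_ord_widen n (fun=> 1) (ltnW (ltn_ord j))) sum1_card card_ord.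
have : [set k : 'I_n | k < j.+1] \subset A.
  by apply/subsetP=> k; rewrite inE ltnS => kj; apply: down kj _; rewrite inE.
move/subset_leq_card; apply: leq_trans.
by rewrite -sum1_card (eq_bigl (fun k : 'I_n => k < j.+1)) => [|k];
  rewrite ?inE // -(big_ord_widen n (fun=> 1) (ltn_ord j)) sum1_card card_ord.
Qed.

Lemma in_rows_inj l m : (forall c, in_rows l c = in_rows m c) -> l = m.
Proof.
move=> e; apply: rowv_inj => i ltin.
have h l' m' : (forall c, in_rows l' c = in_rows m' c) -> rowv l' i <= rowv m' i.
  move=> {}e; rewrite leqNgt; apply/negP => lt.
  have ltn : rowv m' i < n by apply: leq_trans lt (rowv_le _ _).
  by have := e (Ordinal ltin, Ordinal ltn); rewrite /in_rows /= ltnn lt.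
by apply/eqP; rewrite eqn_leq !h.
Qed.

Lemma hstrip_chain l m i i' : hstrip l m -> i < i' -> rowv l i' <= rowv m i.
Proof.
move/hstripP=> h; elim: i' => // i' IH; rewrite ltnS leq_eqVlt => /orP[/eqP->|/IH IHi].
  by have [] := h i'.
by have := h i'; lia.
Qed.

Definition prune r t : {ffun grid -> 'I_N.+1} :=
  [ffun c => if t c == r :> nat then ord_max else t c].

Definition refill r l m t : {ffun grid -> 'I_N.+1} :=
  [ffun c => if in_rows l c && ~~ in_rows m c then inord r else t c].

Section Step.
Variables (r : nat) (l : rows n).
Hypothesis rN : r < N.

(** A strictly increasing column holds the largest letter [r] at most once, so its cells form a
    horizontal strip. *)
Lemma prune_shape t : t \in tableau l r.+1 ->
  let m := cells_below t r in
  [/\ hstrip l m, sz l = sz m + nth 0 mu r & prune r t \in tableau m r].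
Proof.
move=> tT m; have [t1 t2 [t3 t4] t5] := tableauP _ _ _ tT.
have inm c : in_rows m c = (t c < r) by apply: in_cells_below.
have inl c : in_rows l c = (t c < r.+1).
  by case: (boolP (in_rows l c)) => [/t3 ->|/t4 ->] //; lia.
split.
- apply/hstripP => i; case: (ltnP i n) => ltin; last by rewrite !rowv_default //; lia.
  split.
    rewrite leqNgt; apply/negP => lt; have ltn := leq_trans lt (rowv_le m i).
    have := inm (Ordinal ltin, Ordinal ltn); rewrite /in_rows /= lt => /esym lr.
    have := inl (Ordinal ltin, Ordinal ltn); rewrite /in_rows /= ltnn.
    by rewrite ltnS (ltnW lr).
  case: (ltnP i.+1 n) => ltin1; last by rewrite (rowv_default _ ltin1).
  rewrite leqNgt; apply/negP => lt; have ltn := leq_trans lt (rowv_le l i.+1).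
  have := inl (Ordinal ltin1, Ordinal ltn); rewrite /in_rows /= lt => /esym lr.
  have := inm (Ordinal ltin, Ordinal ltn); rewrite /in_rows /= ltnn.
  move/esym/negbT; rewrite -leqNgt => h.
  by have := t2 (Ordinal ltin, Ordinal ltn) (Ordinal ltin1, Ordinal ltn) erefl;
    rewrite /= ltnSn; lia.
- rewrite -!card_in_rows -(t5 r) // -cardsUI.
  rewrite [X in _ = _ + X](_ : _ = 0); last first.
    by apply: eq_card0 => c; rewrite !inE inm; lia.
  by rewrite addn0; apply: eq_card => c; rewrite !inE inm inl; lia.
apply/tableauP; split.
- move=> c d e le; have := t1 c d e le; rewrite !ffunE.
  case: (eqVneq (t c : nat) r) => ec; case: (eqVneq (t d : nat) r) => ed //=;
    have := ltn_ord (t d); have := ltn_ord (t c); try lia.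
  case: (boolP (in_rows l d)) => [/t3|/t4]; lia.
- move=> c d e lt; have := t2 c d e lt; rewrite !ffunE.
  case: (eqVneq (t c : nat) r) => ec; case: (eqVneq (t d : nat) r) => ed //=; try lia.
  by case: (boolP (in_rows l d)) => [/t3|/t4]; lia.
- split=> c; rewrite inm ffunE; first by case: eqVneq => //=; lia.
  case: (eqVneq (t c : nat) r) => // ne h; apply: t4; rewrite inl; lia.
- move=> j jr jN; rewrite -(t5 j) //; last by lia.
  apply: eq_card => c; rewrite !inE ffunE; case: (eqVneq (t c : nat) r) => //= ->.
  by lia.
Qed.

Lemma refill_tableau m t : hstrip l m -> sz l = sz m + nth 0 mu r ->
  t \in tableau m r -> refill r l m t \in tableau l r.+1.
Proof.
move=> h sl tT; have [t1 t2 [t3 t4] t5] := tableauP _ _ _ tT.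
have ml c : in_rows m c -> in_rows l c.
  by rewrite /in_rows; have /hstripP/(_ c.1)[] := h; lia.
have v c : refill r l m t c = (if in_rows l c && ~~ in_rows m c then r else t c) :> nat.
  by rewrite ffunE; case: ifP => // _; rewrite inordK // ltnS ltnW.
apply/tableauP; split.
- move=> c d e le; rewrite !v; have := t1 c d e le; have := t3 c; have := t4 c.
  have : in_rows m d -> in_rows m c by rewrite /in_rows e; lia.
  have : in_rows l d -> in_rows l c by rewrite /in_rows e; lia.
  have := t4 d; have := ml d; have := ltn_ord (t c).
  case: (in_rows l c); case: (in_rows l d); case: (in_rows m c); case: (in_rows m
    d) => //=; lia.
- move=> c d e lt; rewrite !v; have := t2 c d e lt; have := t3 c; have := t4 d.
  (* By interlacing, a cell strictly above a cell of [l] lies in [m], so only letters smaller than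
     [r] stand above a new [r]. *)
  have : in_rows l d -> in_rows m c.
    by rewrite /in_rows e; have := hstrip_chain h lt; lia.
  have := ml c; have := ml d; have := t3 d.
  case: (in_rows l c); case: (in_rows l d); case: (in_rows m c); case: (in_rows m
    d) => //=; lia.
- split=> c hc; rewrite v.
    by rewrite hc; case: (boolP (in_rows m c)) => [/t3|] //=; lia.
  by rewrite (negbTE hc) /= t4 //; apply: contra hc; apply: ml.
- move=> j; rewrite ltnS leq_eqVlt => /orP[/eqP -> _|jr jN].
    have : sz m + #|[set c | refill r l m t c == r :> nat]| = sz l; last by lia.
    rewrite -!card_in_rows -cardsUI [X in _ + X](_ : _ = 0); last first.
      by apply: eq_card0 => c; rewrite !inE v; case: (boolP (in_rows m c)) =>
        [/t3|_] //; rewrite andbF; lia.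
    rewrite addn0; apply: eq_card => c; rewrite !inE v.
    have := ml c; have := t3 c; have := t4 c.
    case: (in_rows l c); case: (in_rows m c) => //=; rewrite ?eqxx //.
      by move=> _ _ ->.
    by move=> -> // _ _; apply/eqP; lia.
  rewrite -t5 //; apply: eq_card => c; rewrite !inE v.
  case: ifP => // /andP[_ /t4 ->]; apply/eqP/eqP; lia.
Qed.

Lemma pruneK t : t \in tableau l r.+1 -> refill r l (cells_below t r) (prune r t) = t.
Proof.
move=> tT; have [t1 t2 [t3 t4] t5] := tableauP _ _ _ tT.
apply/ffunP=> c; rewrite ffunE in_cells_below // -leqNgt; apply: val_inj.
case: (boolP (in_rows l c)) => [/t3|/t4] h /=; rewrite ?ffunE.
  case: leqP => h2; first by rewrite inordK; lia.
  by case: eqVneq h2 => // ->; rewrite ltnn.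
by case: eqVneq => //; rewrite h => e; move: rN; rewrite e ltnn.
Qed.

Lemma refillK m t : hstrip l m -> t \in tableau m r ->
  prune r (refill r l m t) = t /\ cells_below (refill r l m t) r = m.
Proof.
move=> h tT; have [t1 t2 [t3 t4] t5] := tableauP _ _ _ tT.
have ml c : in_rows m c -> in_rows l c.
  by rewrite /in_rows; have /hstripP/(_ c.1)[] := h; lia.
have v c : refill r l m t c = (if in_rows l c && ~~ in_rows m c then r else t c) :> nat.
  by rewrite ffunE; case: ifP => // _; rewrite inordK // ltnS ltnW.
split.
  apply/ffunP=> c; apply: val_inj; rewrite ffunE v /=.
  case: (boolP (in_rows m c)) => [mc|mc]; rewrite ?andbF ?andbT.
    by have := t3 c mc; case: eqVneq => [->|_ _]; rewrite ?ltnn // v mc andbF.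
  have tc := t4 c mc; case: (boolP (in_rows l c)) => lc; first by rewrite eqxx /= tc.
  rewrite tc; case: eqVneq => [e|_]; first by move: rN; rewrite e ltnn.
  by rewrite v (negbTE lc).
apply: in_rows_inj => c; rewrite in_cells_below => [|{}c d e le].
  rewrite v; case: (boolP (in_rows m c)) => [mc|mc]; first by rewrite andbF t3.
  by rewrite andbT t4 //; case: ifP; lia.
rewrite !v; have := t1 c d e le; have := t3 c; have := t4 c.
have : in_rows m d -> in_rows m c by rewrite /in_rows e; lia.
have : in_rows l d -> in_rows l c by rewrite /in_rows e; lia.
have := t4 d; have := ml d; have := ltn_ord (t c).
case: (in_rows l c); case: (in_rows l d); case: (in_rows m c); case: (in_rows m
  d) => //=; lia.
Qed.

Lemma card_tableauS : #|tableau l r.+1|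
  = \sum_(m | hstrip l m && (sz l == sz m + nth 0 mu r)) #|tableau m r|.
Proof.
rewrite -sum1_card (partition_big (fun t => cells_below t r)
  (fun m => hstrip l m && (sz l == sz m + nth 0 mu r))) /=; last first.
  by move=> t /prune_shape[-> -> _]; rewrite eqxx.
apply: eq_bigr => m /andP[h /eqP e]; rewrite sum1_card.
rewrite -(card_in_imset (f := prune r)); last first.
  move=> t t' /andP[tT /eqP tm] /andP[tT' /eqP tm'] et.
  by rewrite -(pruneK tT) -(pruneK tT') tm tm' et.
apply: eq_card => t; apply/imsetP/idP => [[t' /andP[tT /eqP tm] ->]|tT].
  by have [_ _] := prune_shape tT; rewrite tm.
have [e1 e2] := refillK h tT; exists (refill r l m t) => //.
by rewrite unfold_in /= refill_tableau // e2 eqxx.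
Qed.

End Step.

Lemma card_tableau0 l : #|tableau l 0| = (sz l == 0).
Proof.
rewrite sz_eq0P; case: eqVneq => [->|ne] /=.
  rewrite -(cards1 ([ffun=> ord_max] : {ffun grid -> 'I_N.+1})).
  apply: eq_card => t; apply/tableauP/set1P => [[_ _ [_ h] _]|->].
    by apply/ffunP=> c; rewrite ffunE; apply: val_inj; rewrite /= h // /in_rows rowv0.
  split=> //.
  - by move=> c d _ _; rewrite !ffunE.
  - by move=> c d _ _; rewrite !ffunE ltnn.
  by split=> c; rewrite /in_rows rowv0 // ffunE.
apply: eq_card0 => t; apply/negP => /tableauP[_ _ [h _] _].
case/negP: ne; rewrite -sz_eq0P -card_in_rows; apply/eqP/eq_card0 => c.
by rewrite inE; apply/negP => /h.
Qed.

Lemma card_tableau l r : r <= N -> #|tableau l r| = nchains l (rev (take r mu)).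
Proof.
elim: r l => [|r IH] l rN; first by rewrite take0 card_tableau0.
rewrite card_tableauS // (take_nth 0) // rev_rcons /=.
by apply: eq_bigr => m _; apply: IH; apply: ltnW.
Qed.

(** Filling up the grid puts tableaux of all shapes into one type, so that deleting a letter does
    not change the type. *)
Definition extend_tableau (la : part n) (T : {ffun cell la -> 'I_N}) :
    {ffun grid -> 'I_N.+1} :=
  [ffun c => if insub c is Some x then widen_ord (leqnSn N) (T x) else ord_max].

Lemma extend_val la (T : {ffun cell la -> 'I_N}) (x : cell la) :
  extend_tableau T (val x) = T x :> nat.
Proof. by rewrite ffunE valK. Qed.

Lemma extend_out la (T : {ffun cell la -> 'I_N}) c :
  ~~ in_diagram la c -> extend_tableau T c = N :> nat.
Proof. by move=> h; rewrite ffunE insubN. Qed.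

Lemma kostka_tableau (la : part n) : kostka la mu = #|tableau (val la) N|.
Proof.
rewrite /kostka -(card_imset _ (f := @extend_tableau la)); last first.
  move=> T T' e; apply/ffunP=> x; apply: val_inj.
  by rewrite /= -!extend_val e.
apply: eq_card => t; apply/imsetP/idP => [[T] | tT].
  rewrite inE => /and3P[/forallP h1 /forallP h2 /forallP h3] ->.
  apply/tableauP; split.
  - move=> c d e le; case: (boolP (in_diagram la d)) => ld; last first.
      by rewrite (extend_out T ld) -ltnS.
    have lc : in_diagram la c by move: ld; rewrite /in_diagram e; lia.
    rewrite -[c]/(val (Sub c lc : cell la)) -[d]/(val (Sub d ld : cell la)) !extend_val.
    by have /forallP/(_ (Sub d ld)) := h1 (Sub c lc); rewrite /= e eqxx le.
  - move=> c d e lt; case: (boolP (in_diagram la d)) => ld; last first.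
      by rewrite (extend_out T ld) ltnn.
    move=> _; have lc : in_diagram la c.
      move: ld; rewrite /in_diagram e => ld; apply: leq_trans ld _.
      elim: {d e} (d.1 : nat) lt => // i IH; rewrite ltnS leq_eqVlt => /orP[/eqP<-|/IH].
        exact: parts_nonincr.
      by apply: leq_trans; apply: parts_nonincr.
    rewrite -[c]/(val (Sub c lc : cell la)) -[d]/(val (Sub d ld : cell la)) !extend_val.
    by have /forallP/(_ (Sub d ld)) := h2 (Sub c lc); rewrite /= e eqxx lt.
  - split=> c; last exact: extend_out.
    by move=> lc; rewrite -[c]/(val (Sub c lc : cell la)) extend_val.
  - move=> j _ jN; have /eqP <- := h3 (Ordinal jN).
    rewrite -(card_imset _ (@val_inj _ _ (cell la))).
    apply: eq_card => c; rewrite inE; apply/idP/imsetP => [|[x]].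
      case: (boolP (in_diagram la c)) => lc; last by rewrite (extend_out T lc) =>
        /eqP e; exfalso; lia.
      rewrite -{1}[c]/(val (Sub c lc : cell la)) extend_val => e.
      by exists (Sub c lc) => //; rewrite inE.
    by rewrite inE => /eqP e ->; rewrite extend_val e.
have [t1 t2 [t3 t4] t5] := tableauP _ _ _ tT.
pose T : {ffun cell la -> 'I_N} := [ffun x : cell la => Ordinal (t3 _ (valP x))].
have Tv x : T x = t (val x) :> nat by rewrite ffunE.
have et : t = extend_tableau T.
  apply/ffunP=> c; apply: val_inj => /=.
  case: (boolP (in_diagram la c)) => lc; last by rewrite extend_out // t4.
  by rewrite -[c]/(val (Sub c lc : cell la)) extend_val Tv.
exists T => //; rewrite inE; apply/and3P; split.
- apply/forallP=> c; apply/forallP=> d; apply/implyP=> /andP[/eqP e le].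
  by rewrite !Tv; apply: t1.
- apply/forallP=> c; apply/forallP=> d; apply/implyP=> /andP[/eqP e lt].
  by rewrite !Tv; apply: t2 => //; apply: t3 (valP d).
apply/forallP=> j; rewrite -(t5 j) // -(card_imset _ (@val_inj _ _ (cell la))).
apply/eqP; apply: eq_card => c; rewrite inE; apply/imsetP/idP => [[x]|].
  by rewrite inE => /eqP e ->; rewrite -Tv e.
case: (boolP (in_diagram la c)) => lc; last by rewrite t4 // => /eqP e; have :=
  ltn_ord j; rewrite -e ltnn.
move=> e; exists (Sub c lc) => //; rewrite inE -val_eqE /= Tv; exact: e.
Qed.

Lemma kostkaE (la : part n) : kostka la mu = gelfand_tsetlin la mu.
Proof. by rewrite kostka_tableau card_tableau // take_size. Qed.

End Tableaux.

(** * Pairs of words and matrices with given margins *)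

Definition subseqn (b v : seq nat) := [seq p.1 - p.2 | p <- zip b v].

(** [rems] and [mats] list without repetition what [removals] and [nmats] sum over or count; pairs
    of words are then sorted along this list. *)
Fixpoint rems a (b : seq nat) : seq (seq nat) :=
  if b is c :: b' then
    [seq j :: v | j <- [seq j <- iota 0 a.+1 | j <= c], v <- rems (a - j) b']
  else if a == 0 then [:: [::]] else [::].

Fixpoint mats (a b : seq nat) : seq (seq (seq nat)) :=
  if a is c :: a' then [seq v :: A | v <- rems c b, A <- mats a' (subseqn b v)]
  else if sumn b == 0 then [:: [::]] else [::].

Lemma rems_cons a c b : rems a (c :: b) =
  [seq j :: v | j <- [seq j <- iota 0 a.+1 | j <= c], v <- rems (a - j) b].
Proof. by []. Qed.

Lemma removals_rems a b (Phi : seq nat -> nat) :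
  removals a b Phi = \sum_(v <- rems a b) Phi (subseqn b v).
Proof.
elim: b a Phi => [|c b IH] a Phi.
  by rewrite /=; case: eqP => _; rewrite ?big_nil ?big_seq1.
rewrite rems_cons big_allpairs_dep big_filter [LHS]/=.
rewrite -[iota 0 a.+1]/(index_iota 0 a.+1) big_mkord; apply: eq_bigr => j _.
by rewrite IH.
Qed.

Lemma size_mats a b : size (mats a b) = nmats a b.
Proof.
elim: a b => [|c a IH] b /=; first by case: eqP.
rewrite size_allpairs_dep removals_rems sumnE big_map.
by apply: eq_bigr => v _; rewrite IH.
Qed.

Lemma mem_rems a b v : (v \in rems a b) =
  [&& size v == size b, all2 leq v b & sumn v == a].
Proof.
elim: b a v => [|c b IH] a v; last rewrite rems_cons.
  by rewrite /=; case: eqP => [->|h]; rewrite ?inE; case: v => //=; rewrite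
    eq_sym; case: eqP.
apply/allpairsPdep/idP => [[j [w []]]|].
  rewrite mem_filter mem_iota IH => /andP[jc ja] /and3P[/eqP sw aw /eqP e] -> /=.
  by rewrite sw eqxx jc aw /=; lia.
case: v => [//|j w] /and3P[sw /andP[jc aw] /eqP sj]; exists j, w.
have {}aw : all2 leq w b := aw.
move: sj; rewrite -[sumn _]/(j + sumn w) => sj.
by rewrite mem_filter mem_iota IH jc (_ : size w == size b) // aw; split=> //; lia.
Qed.

Lemma uniq_rems a b : uniq (rems a b).
Proof.
elim: b a => [|c b IH] a; first by rewrite /=; case: eqP.
rewrite rems_cons; apply: allpairs_uniq_dep; first by rewrite filter_uniq ?iota_uniq.
  by move=> j _; apply: IH.
by move=> [j v] [j' v'] _ _ /= [-> ->].
Qed.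

Lemma uniq_mats a b : uniq (mats a b).
Proof.
elim: a b => [|c a IH] b /=; first by case: eqP.
apply: allpairs_uniq_dep; first exact: uniq_rems.
  by move=> v _; apply: IH.
by move=> [j v] [j' v'] _ _ /= [-> ->].
Qed.

Lemma size_subseqn b v : size v = size b -> size (subseqn b v) = size b.
Proof. by move=> e; rewrite size_map size_zip e minnn. Qed.

Lemma nth_subseqn b v j : size v = size b ->
  nth 0 (subseqn b v) j = nth 0 b j - nth 0 v j.
Proof.
move=> e; case: (ltnP j (size b)) => h.
  by rewrite (nth_map (0, 0)) ?size_zip ?e ?minnn // nth_zip.
by rewrite !nth_default ?size_subseqn ?e.
Qed.

Lemma all2_leqP v b : size v = size b ->
  reflect (forall j, nth 0 v j <= nth 0 b j) (all2 leq v b).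
Proof.
elim: v b => [|x v IH] [|y b] //=; first by move=> _; left=> j; rewrite nth_nil.
case=> /IH IHb; apply: (iffP andP) => [[xy /IHb h] [|j] //=|h].
by split; [exact: (h 0) | apply/IHb => j; exact: (h j.+1)].
Qed.

Lemma matsP a b A : reflect [/\ size A = size a,
   forall i, i < size a -> size (nth [::] A i) = size b,
   forall i, sumn (nth [::] A i) = nth 0 a i &
   forall j, \sum_(i < size a) nth 0 (nth [::] A i) j = nth 0 b j] (A \in mats a b).
Proof.
elim: a b A => [|c a IH] b A /=.
  apply: (iffP idP).
    case: eqP => // b0; rewrite inE => /eqP ->; split=> // [i|j].
      by rewrite !nth_nil.
    rewrite big_ord0; elim: b b0 j => [|x b IHb] /= b0 [|j] //=; first by lia.
    by apply: IHb; lia.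
  case=> /size0nil -> _ _ h; rewrite (_ : sumn b == 0) ?inE //.
  have: forall j, nth 0 b j = 0 by move=> j; rewrite -h big_ord0.
  elim: b {h} => [|x b IHb] //= hb; rewrite addn_eq0 [x](hb 0) /=.
  by apply: IHb => j; apply: (hb j.+1).
apply: (iffP allpairsPdep) => [[v [B []]]|].
  rewrite mem_rems => /and3P[/eqP sv av /eqP vc] /IH[sB h1 h2 h3] ->.
  split=> /= [|[|i]|[|i]|j] //=; rewrite ?sB //.
    by rewrite ltnS => /h1 ->; rewrite size_subseqn.
  rewrite big_ord_recl /= h3 nth_subseqn //.
  by move/all2_leqP: av => /(_ sv j); lia.
case: A => [|v B] [] //= [sB] h1 h2 h3; exists v, B.
have sv := h1 0 isT; rewrite /= in sv.
have le j : nth 0 v j <= nth 0 b j by rewrite -h3 big_ord_recl /=; lia.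
split=> //.
  by rewrite mem_rems sv eqxx (h2 0) eqxx andbT; apply/all2_leqP.
apply/IH; split=> // [i lti|i|j].
- by rewrite size_subseqn //; exact: (h1 i.+1).
- exact: (h2 i.+1).
by rewrite nth_subseqn // -h3 big_ord_recl /= addKn; apply: eq_bigr.
Qed.

Section Counting.
Variables (n : nat).

Lemma exists_word (X : finType) (k : X -> nat) : \sum_x k x = n ->
  exists h : {ffun 'I_n -> X}, forall x, wcount h x = k x.
Proof.
move=> e; pose s := flatten [seq nseq (k x) x | x <- enum X].
have ss : size s == n.
  rewrite size_flatten /shape -map_comp sumnE big_map -e big_enum /=.
  by apply/eqP/eq_bigr => x _; rewrite size_nseq.
exists [ffun i => tnth (Tuple ss) i] => x; rewrite wcountE.
rewrite (eq_map (g := tnth (Tuple ss))); last by move=> i; rewrite ffunE.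
rewrite map_tnth_enum /= count_flatten -map_comp sumnE big_map big_enum /=.
rewrite (bigD1 x) //= count_nseq /= eqxx mul1n big1 ?addn0 // => y yx.
by rewrite count_nseq /= (negbTE yx).
Qed.

Variables (a b : seq nat).
Let p := size a.
Let q := size b.
Implicit Types h : {ffun 'I_n -> 'I_p * 'I_q}.

(** A pair of words is one word in the product alphabet; its letter counts form a matrix whose
    margins are the two contents. *)
Definition word_matrix h : seq (seq nat) :=
  [seq [seq wcount h (i, j) | j <- enum 'I_q] | i <- enum 'I_p].

Lemma size_word_matrix h : size (word_matrix h) = p.
Proof. by rewrite size_map size_enum_ord. Qed.

Lemma nth_word_matrix h (i : 'I_p) :
  nth [::] (word_matrix h) i = [seq wcount h (i, j) | j <- enum 'I_q].
Proof. by rewrite (nth_map i) ?size_enum_ord // nth_ord_enum. Qed.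

Lemma nth2_word_matrix h (i : 'I_p) (j : 'I_q) :
  nth 0 (nth [::] (word_matrix h) i) j = wcount h (i, j).
Proof. by rewrite nth_word_matrix (nth_map j) ?size_enum_ord // nth_ord_enum. Qed.

Definition pair_word (fg : {ffun 'I_n -> 'I_p} * {ffun 'I_n -> 'I_q}) :
  {ffun 'I_n -> 'I_p * 'I_q} := [ffun i => (fg.1 i, fg.2 i)].

Lemma pair_word_inj : injective pair_word.
Proof.
move=> [f g] [f' g'] /ffunP e; congr (_, _); apply/ffunP=> i; have := e i;
  by rewrite !ffunE; case.
Qed.

Lemma wcount_pair1 f g i : wcount f i = \sum_j wcount (pair_word (f, g)) (i, j).
Proof.
rewrite /wcount -sum1_card (partition_big g predT) //=.
apply: eq_bigr => j _; rewrite -sum1_card; apply: eq_bigl => x.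
by rewrite !inE ffunE xpair_eqE.
Qed.

Lemma wcount_pair2 f g j : wcount g j = \sum_i wcount (pair_word (f, g)) (i, j).
Proof.
rewrite /wcount -sum1_card (partition_big f predT) //=.
apply: eq_bigr => i _; rewrite -sum1_card; apply: eq_bigl => x.
by rewrite !inE ffunE xpair_eqE andbC.
Qed.

Lemma word_matrix_pair f g : (word_matrix (pair_word (f, g)) \in mats a b) =
  (f \in content_words n a) && (g \in content_words n b).
Proof.
apply/matsP/andP => [[_ h1 h2 h3]|].
  rewrite !inE; split; apply/forallP=> i; apply/eqP.
    rewrite -h2 nth_word_matrix sumnE big_map big_enum /=; exact: wcount_pair1.
  rewrite -h3 (wcount_pair2 f); apply: eq_bigr => k _; exact/esym/nth2_word_matrix.
rewrite !inE => -[/forallP hf /forallP hg]; split.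
- exact: size_word_matrix.
- by move=> i lti; rewrite -[ i ]/(val (Ordinal lti)) nth_word_matrix size_map
  size_enum_ord.
- move=> i; case: (ltnP i p) => lti; last by rewrite !nth_default ?size_word_matrix.
  rewrite -[ i ]/(val (Ordinal lti)) nth_word_matrix -(eqP (hf _)).
  by rewrite sumnE big_map big_enum (wcount_pair1 _ g).
move=> j; case: (ltnP j q) => ltj.
  rewrite -[j]/(val (Ordinal ltj)) -(eqP (hg _)) (wcount_pair2 f).
  by apply: eq_bigr => i _; rewrite nth2_word_matrix.
rewrite [RHS]nth_default // big1 // => i _; rewrite nth_default //.
by rewrite nth_word_matrix size_map size_enum_ord.
Qed.

Lemma wfix_pair f g s : wfix (pair_word (f, g)) s = wfix f s && wfix g s.
Proof.
apply/forallP/andP => [h|[/forallP hf /forallP hg] i].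
  by split; apply/forallP=> i; have := h i; rewrite !ffunE xpair_eqE => /andP[].
by rewrite !ffunE xpair_eqE hf hg.
Qed.

Lemma word_fix_mul s : word_fix a s * word_fix b s
  = \sum_(A <- mats a b) #|[set h | (word_matrix h == A) && wfix h s]|.
Proof.
rewrite /word_fix -cardsX -(card_imset _ pair_word_inj).
transitivity (\sum_(h | (word_matrix h \in mats a b) && wfix h s) 1).
  rewrite sum1_card; apply: eq_card => h; rewrite unfold_in.
  apply/imsetP/andP => [[[f g]]|[hm hs]].
    by rewrite !inE /= => /andP[/andP[hf gf] /andP[hg gg]] ->; rewrite
      word_matrix_pair wfix_pair !inE hf hg gf.
  pose f := [ffun i => (h i).1]; pose g := [ffun i => (h i).2].
  have e : h = pair_word (f, g) by apply/ffunP=> i; rewrite !ffunE; case: (h i).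
  exists (f, g) => //; move: hm hs; rewrite e word_matrix_pair wfix_pair !inE /=.
  by case/andP=> -> -> /andP[-> ->].
under [RHS]eq_bigr => A _ do rewrite -sum1_card big_mkcond.
rewrite exchange_big /= [LHS]big_mkcond; apply: eq_bigr => h _.
under [RHS]eq_bigr => A _ do rewrite inE.
case: (wfix h s); last by rewrite andbF big1 // => A _; rewrite andbF.
rewrite andbT; case: ifP => hm.
  rewrite (bigD1_seq _ hm (uniq_mats _ _)) /= eqxx big1 // => A ne.
  by rewrite eq_sym (negbTE ne).
rewrite big_seq big1 // => A hA; case: eqP => // e.
by rewrite e hA in hm.
Qed.

Lemma sum_word_fix2 : sumn a = n ->
  \sum_(s : 'S_n) word_fix a s * word_fix b s = n`! * nmats a b.
Proof.
move=> sa; under eq_bigr => s _ do rewrite word_fix_mul.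
rewrite exchange_big /= -size_mats mulnC -sum1_size big_distrl /=.
rewrite big_seq [RHS]big_seq; apply: eq_bigr => A /matsP[sA h1 h2 h3].
rewrite mul1n; pose k (x : 'I_p * 'I_q) := nth 0 (nth [::] A x.1) x.2.
have [h0 hh0] : exists h0, forall x, wcount h0 x = k x.
  apply: exists_word; rewrite -sa -(pair_big predT predT (fun (i : 'I_p) (j :
    'I_q) => k (i, j))) /=.
  rewrite [RHS]sumnE (big_nth 0) big_mkord; apply: eq_bigr => i _.
  by rewrite -h2 sumnE (big_nth 0) h1 // big_mkord.
have eA h : (word_matrix h == A) = (h \in wclass h0).
  rewrite inE; apply/eqP/forallP => [e x|e].
    by rewrite hh0 /k -e; case: x => i j; rewrite nth2_word_matrix.
  apply: (@eq_from_nth _ [::]); rewrite size_word_matrix ?sA // => i lti.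
  apply: (@eq_from_nth _ 0).
    by rewrite -[ i ]/(val (Ordinal lti)) nth_word_matrix size_map size_enum_ord h1.
  move=> j; rewrite -[ i ]/(val (Ordinal lti)) {1}nth_word_matrix size_map
    size_enum_ord => ltj.
  rewrite -[j]/(val (Ordinal ltj)) nth2_word_matrix (eqP (e _)) hh0 //.
rewrite -[RHS](sum_wfix h0); apply: eq_bigr => s _; apply: eq_card => h.
by rewrite !inE eA inE.
Qed.

End Counting.

(** * Maps, set partitions and words of hook content *)

Local Notation hook_content n l := ((n - l)%N :: nseq l 1%N) (only parsing).

Section Hook.
Variables (n l : nat) (s : 'S_n).
Implicit Types (u : {ffun 'I_l -> 'I_n}).
Notation N := (size (nseq l 1)).

Definition inj_words := [set u : {ffun 'I_l -> 'I_n} | injectiveb u && [forall j,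
  s (u j) == u j]].

(** Letter [j.+1] marks the position [u j], and letter 0 fills the other [n - l] positions. *)
Definition hook_word u : {ffun 'I_n -> 'I_N.+1} :=
  [ffun p => if [pick j | u j == p] is Some j then inord j.+1 else ord0].

Lemma hook_wordE u p : injective u -> forall j, (hook_word u p == j.+1 :> nat) =
  (j < l) && [exists j' : 'I_l, (j' == j :> nat) && (u j' == p)].
Proof.
move=> iu j; rewrite ffunE; case: pickP => [j' /eqP uj|none] /=.
  rewrite inordK ?size_nseq ?ltnS // eqSS; apply/eqP/andP => [<-|[_ /existsP[i
    /andP[/eqP <- /eqP ui]]]].
    by split=> //; apply/existsP; exists j'; rewrite uj !eqxx.
  by congr nat_of_ord; apply: iu; rewrite uj ui.
by apply/esym/negP => /andP[_ /existsP[i /andP[_ ui]]]; rewrite none in ui.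
Qed.

Lemma hook_word_at u j : injective u -> hook_word u (u j) = j.+1 :> nat.
Proof.
move=> iu; apply/eqP; rewrite hook_wordE // ltn_ord; apply/existsP.
by exists j; rewrite !eqxx.
Qed.

Lemma hook_word_out u p : (forall j, u j != p) -> hook_word u p = 0 :> nat.
Proof. by move=> h; rewrite ffunE; case: pickP => // j; rewrite (negbTE (h j)). Qed.

Lemma hook_word_in u p (j : 'I_l) : injective u -> hook_word u p = j.+1 :> nat -> u j = p.
Proof.
move=> iu /eqP; rewrite hook_wordE // => /andP[_ /existsP[i /andP[/eqP e /eqP <-]]].
by congr (u _); apply: val_inj.
Qed.

(** Each nonzero letter occurs once, so [s] fixes the word exactly when it fixes every marked
    position. *)
Lemma card_inj_words : l <= n ->
  #|inj_words| = word_fix (hook_content n l) s.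
Proof.
move=> ln; rewrite /word_fix -(card_in_imset (f := hook_word)); last first.
  move=> u v; rewrite !inE => /andP[/injectiveP iu _] /andP[/injectiveP iv _] e.
  apply/ffunP => j; apply/esym; apply: (hook_word_in iv).
  by rewrite -e hook_word_at.
apply: eq_card => h; apply/imsetP/idP => [[u]|].
  rewrite inE => /andP[/injectiveP iu /forallP us] ->; rewrite !inE; apply/andP; split.
    apply/forallP => -[[|j] /= ltj]; apply/eqP.
      have nl : l + #|[predC (mem (codom u))]| = n.
        by have := cardC (mem (codom u)); rewrite card_ord card_codom // card_ord.
      have {}nl : #|[predC (mem (codom u))]| = n - l by rewrite -[LHS](addKn l) nl.
      transitivity #|[predC (mem (codom u))]|; last exact: nl.
      apply: eq_card => p; rewrite !inE -val_eqE /=.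
      apply/eqP/negP => [e /codomP[j ej]|nc].
        by move: e; rewrite ej hook_word_at.
      by apply: hook_word_out => j; apply/eqP => e; apply: nc; rewrite -e codom_f.
    have lj : j < l by have := size_nseq l 1; lia.
    transitivity 1; last by rewrite /= nth_nseq lj.
    transitivity #|[set u (Ordinal lj)]|; last exact: cards1.
    apply: eq_card => p; rewrite !inE -val_eqE /=; apply/eqP/eqP => [e|->].
      by rewrite (@hook_word_in u p (Ordinal lj)).
    by rewrite hook_word_at.
  apply/forallP=> p; apply/eqP; apply: val_inj.
  case: (boolP (p \in codom u)) => [/codomP[j ->]|np]; first by rewrite (eqP (us j)).
  rewrite /= !hook_word_out // => j; apply: contra np => /eqP e; first by rewrite
    -e codom_f.
  have -> : p = u j by apply: (@perm_inj _ s); rewrite (eqP (us j)) e.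
  exact: codom_f.
rewrite !inE => /andP[/forallP hc /forallP hs].
have inordE (j : 'I_l) : (inord j.+1 : 'I_N.+1) = j.+1 :> nat.
  by rewrite inordK // size_nseq ltnS.
have one (j : 'I_l) : wcount h (inord j.+1) == 1.
  by rewrite (eqP (hc _)) inordE /= nth_nseq ltn_ord.
have ex (j : 'I_l) : exists p, h p == inord j.+1.
  by have /cards1P[p e] := one j; exists p; have := set11 p; rewrite -e inE.
have uni (j : 'I_l) p p' : h p = j.+1 :> nat -> h p' = j.+1 :> nat -> p = p'.
  move=> hp hp'; have /cards1P[x e] := one j.
  have inx q : h q = j.+1 :> nat -> q = x.
    by move=> hq; apply/set1P; rewrite -e inE -val_eqE /= hq inordE.
  by rewrite (inx p) // (inx p').
pose u : {ffun 'I_l -> 'I_n} := [ffun j => xchoose (ex j)].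
have hu j : h (u j) = j.+1 :> nat.
  by rewrite ffunE (eqP (xchooseP (ex j))) inordE.
have iu : injective u.
  by move=> i j e; apply: val_inj; have := hu i; rewrite e hu => -[].
exists u.
  rewrite inE; apply/andP; split; first exact/injectiveP.
  by apply/forallP=> j; apply/eqP; apply: (uni j); rewrite ?(eqP (hs _)) hu.
apply/ffunP=> p; apply: val_inj => /=; case hp : (nat_of_ord (h p)) => [|j].
  by rewrite hook_word_out // => j; apply/eqP=> e; have := hu j; rewrite e hp.
have lj : j < l by have := ltn_ord (h p); have := size_nseq l 1; lia.
have <- : u (Ordinal lj) = p by apply: (uni (Ordinal lj)).
by rewrite hook_word_at.
Qed.

Lemma card_inj_words_gt : n < l -> #|inj_words| = 0.
Proof.
move=> nl; apply: eq_card0 => u; rewrite inE; apply/negP => /andP[/injectiveP iu _].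
by have := leq_card u iu; rewrite !card_ord; lia.
Qed.

End Hook.

Section Kernel.
Variables (n k : nat) (s : 'S_n).
Implicit Types (P : {set {set 'I_k}}) (g : {ffun 'I_k -> 'I_n}).

Lemma preim_partition_eq P g : partition P [set: 'I_k] ->
  (preim_partition g [set: 'I_k] == P) = [forall i, forall j, (g i == g j) == (j
    \in pblock P i)].
Proof.
move=> Pp; apply/eqP/forallP => [e i|h].
  apply/forallP=> j; rewrite -e pblock_equivalence_partition ?inE //.
  by split=> // /eqP ->.
rewrite -[RHS](equivalence_partition_pblock Pp); apply: eq_in_imset => i _.
by apply/setP => j; rewrite !inE /= (eqP (forallP (h i) j)).
Qed.

Definition fixed_maps := [set g : {ffun 'I_k -> 'I_n} | [forall i, s (g i) == g i]].

(** A map with kernel [P] factors uniquely as an injection of the blocks after [ix], the index of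
    the block of a point, and takes the same values. *)
Lemma card_fixed_maps_kernel P : partition P [set: 'I_k] ->
  #|[set g in fixed_maps | preim_partition g [set: 'I_k] == P]| = #|inj_words #|P| s|.
Proof.
move=> Pp; have /and3P[/eqP covP trivP P0] := Pp.
have inP i : pblock P i \in P by rewrite pblock_mem // covP inE.
pose ix i : 'I_#|P| := enum_rank_in (inP i) (pblock P i).
have ixK i : enum_val (ix i) = pblock P i by rewrite enum_rankK_in.
have ixE i j : (ix i == ix j) = (j \in pblock P i).
  by rewrite -(inj_eq enum_val_inj) !ixK eq_pblock // covP inE.
have ix_surj b : exists i, ix i = b.
  have bP := enum_valP b; have /set0Pn[i ib] : enum_val b != set0.
    by apply: contraNneq P0 => <-.
  by exists i; apply: enum_val_inj; rewrite ixK (def_pblock trivP bP ib).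
pose f (u : {ffun 'I_#|P| -> 'I_n}) : {ffun 'I_k -> 'I_n} := [ffun i => u (ix i)].
rewrite -[RHS](card_imset _ (f := f)); last first.
  move=> u v /ffunP e; apply/ffunP => b; have [i <-] := ix_surj b.
  by have := e i; rewrite !ffunE.
apply: eq_card => g; rewrite !inE preim_partition_eq //; apply/andP/imsetP.
  case=> /forallP gs /forallP gk.
  have {}gk i j : (g i == g j) = (ix i == ix j) by rewrite ixE (eqP (forallP (gk i) j)).
  have ex b : exists i, ix i == b by have [i <-] := ix_surj b; exists i.
  pose u : {ffun 'I_#|P| -> 'I_n} := [ffun b => g (xchoose (ex b))].
  have uix i : u (ix i) = g i.
    by rewrite ffunE; apply/eqP; rewrite gk (xchooseP (ex (ix i))).
  exists u; last by apply/ffunP=> i; rewrite ffunE uix.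
  rewrite inE; apply/andP; split; last first.
    by apply/forallP=> b; rewrite ffunE gs.
  apply/injectiveP=> b c; have [i <-] := ix_surj b; have [j <-] := ix_surj c.
  by rewrite !uix => /eqP; rewrite gk => /eqP.
case=> u; rewrite inE => /andP[/injectiveP iu /forallP us] ->; split.
  by apply/forallP=> i; rewrite ffunE us.
apply/forallP=> i; apply/forallP=> j; rewrite !ffunE (inj_eq iu) ixE.
exact: eqxx.
Qed.

Lemma fixpts_exp : fixpts s ^ k
  = \sum_(0 <= l < n.+1) stirling2 k l * word_fix (hook_content n l) s.
Proof.
transitivity #|fixed_maps|.
  rewrite -[k in LHS]card_ord -card_ffun_on; apply: eq_card => g.
  rewrite [RHS]inE; apply/ffun_onP/forallP => h i; have := h i; by rewrite inE.
rewrite -sum1_card (partition_big (fun g : {ffun 'I_k -> 'I_n} => preim_partition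
  g [set: 'I_k])
  (fun P => partition P [set: 'I_k])) /=; last by move=> g _; apply: preim_partitionP.
transitivity (\sum_(P : {set {set 'I_k}} | partition P [set: 'I_k]) #|inj_words #|P| s|).
  apply: eq_bigr => P Pp; rewrite -card_fixed_maps_kernel // -[RHS]sum1_card.
  by apply: eq_bigl => g; rewrite !inE.
(* Kernels with more than [n] blocks admit no injection into ['I_n], which explains the upper limit
   of the sum. *)
rewrite big_mkord (bigID (fun P : {set {set 'I_k}} => #|P| < n.+1)) /= [X in _ +
  X]big1 ?addn0; last first.
  by move=> P /andP[_ h]; rewrite card_inj_words_gt // ltnNge.
rewrite (partition_big (fun P : {set {set 'I_k}} => inord #|P| : 'I_n.+1) predT) //=.
apply: eq_bigr => l _; rewrite /stirling2 -sum1_card big_distrl /=.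
apply: eq_big => [P|P /andP[/andP[_ h] /eqP e]].
  rewrite inE -andbA; congr (_ && _); case: ltnP => h /=.
    by rewrite -val_eqE /= inordK.
  by apply/esym/eqP => e; have := ltn_ord l; rewrite -e ltnNge h.
rewrite mul1n; have -> : #|P| = l by rewrite -e inordK.
by rewrite card_inj_words // -ltnS.
Qed.

End Kernel.

Local Open Scope ring_scope.

(** * The regular representation *)

Section Idempotents.
Variable F : fieldType.

(** For the rank factorization [P = C *m R], the outer full-rank factors cancel in
    [C (R C) R = C D R]. The trace of [P] is that of [R C]. *)
Lemma base_mulC n (P : 'M[F]_n) (D : 'M[F]_(\rank P)) :
  P *m P = col_base P *m D *m row_base P -> row_base P *m col_base P = D.
Proof.
move=> PP; apply: (row_free_inj (row_base_free P)).
apply: (row_full_inj (col_base_full P)).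
rewrite -[LHS]/(_ *m (_ *m _)) -[RHS]/(_ *m (_ *m _)).
rewrite [RHS]mulmxA -PP.
transitivity ((col_base P *m row_base P) *m (col_base P *m row_base P)).
  by rewrite !mulmxA.
by rewrite mulmx_base.
Qed.

Lemma mxtrace_idem n (P : 'M[F]_n) : P *m P = P -> \tr P = (\rank P)%:R.
Proof.
move=> PP; have BA : row_base P *m col_base P = 1%:M.
  by apply: base_mulC; rewrite mulmx1 PP mulmx_base.
by rewrite -{1}(mulmx_base P) mxtrace_mulC BA mxtrace1.
Qed.

Lemma mxtrace_sqr0 n (A : 'M[F]_n) : A *m A = 0 -> \tr A = 0.
Proof.
move=> AA; have BA : row_base A *m col_base A = 0.
  by apply: base_mulC; rewrite mulmx0 mul0mx.
by rewrite -{1}(mulmx_base A) mxtrace_mulC BA mxtrace0.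
Qed.

(** Write [P = Y *m B] with [B] a basis of [U]; then [B *m Y] is the identity, and cyclicity of the
    trace moves [Y] around. *)
Lemma mxtrace_submod_idem (gT : finGroupType) (G : {group gT}) n
    (rG : mx_representation F G n) (U P : 'M[F]_n) (modU : mxmodule rG U) s :
  s \in G -> P *m P = P -> P *m rG s = rG s *m P -> (P :=: U)%MS ->
  \tr (submod_repr modU s) = \tr (P *m rG s).
Proof.
move=> Gs PP Ps PU; pose B := row_base U.
have BS : submod_repr modU s *m B = B *m rG s.
  have := val_submodJ modU (1%:M : 'M[F]_(\rank U)) Gs.
  by rewrite mul1mx /val_submod /= mul1mx.
have BP : B *m P = B.
  have /submxP[D ->] : (B <= P)%MS by rewrite PU eq_row_base.
  by rewrite -mulmxA PP.
have /submxP[Y PY] : (P <= B)%MS by rewrite eq_row_base PU.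
have BY : B *m Y = 1%:M.
  apply: (row_free_inj (row_base_free U)).
  by rewrite -[RHS]/(_ *m _) mul1mx -[RHS]BP PY mulmxA.
by rewrite PY -mulmxA -BS mulmxA [RHS]mxtrace_mulC mulmxA BY mul1mx.
Qed.

End Idempotents.

Section Regular.
Variables (F : fieldType) (gT : finGroupType).
Let G : {group gT} := [set: gT]%G.
Let aG := regular_repr F G.

Lemma regM x y : aG (x * y)%g = aG x *m aG y.
Proof. by rewrite repr_mxM ?inE. Qed.

Lemma regKV x : aG x *m aG x^-1%g = 1%:M.
Proof. by rewrite -regM mulgV repr_mx1. Qed.

Lemma mxtrace_reg x : \tr (aG x) = (if x == 1%g then #|G|%:R else 0) :> F.
Proof.
case: eqP => [->|/eqP x1]; first by rewrite repr_mx1 mxtrace1.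
rewrite /mxtrace big1 // => i _; rewrite mxE mxE /=.
case: eqP => // /(congr1 enum_val); rewrite gring_indexK ?inE // => e.
case/negP: x1; apply/eqP; apply: (mulgI (enum_val i)).
by rewrite mulg1 -e.
Qed.

Lemma gring_mxE (u : 'rV[F]_#|G|) :
  gring_mx aG u = \sum_x u 0 (gring_index G x) *: aG x.
Proof.
rewrite /gring_mx /= mulmx_sum_row linear_sum /=.
rewrite (reindex (gring_index G)) /=.
  by apply: eq_bigr => x _; rewrite linearZ /= rowK mxvecK gring_indexK ?inE.
exists enum_val => [x _|i _]; first by rewrite gring_indexK ?inE.
by rewrite gring_valK.
Qed.

Lemma gring_mx_delta x : gring_mx aG (delta_mx 0 (gring_index G x)) = aG x.
Proof.
rewrite gring_mxE (bigD1 x) //= mxE !eqxx scale1r big1 ?addr0 // => y yx.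
rewrite mxE eqxx /= (inj_in_eq (can_in_inj (@gring_indexK _ G))) ?inE //.
by rewrite (negbTE yx) scale0r.
Qed.

(** The regular character vanishes off the identity, so a trace reads off one coefficient. *)
Lemma gring_coef (u : 'rV[F]_#|G|) y :
  \tr (gring_mx aG u *m aG y^-1%g) = #|G|%:R * u 0 (gring_index G y).
Proof.
rewrite gring_mxE mulmx_suml linear_sum /= (bigD1 y) //= big1 ?addr0.
  by rewrite -scalemxAl mxtraceZ regKV mxtrace1 mulrC.
move=> x xy; rewrite -scalemxAl -regM mxtraceZ mxtrace_reg.
by rewrite -(inj_eq (mulIg y)) mulgKV mul1g (negbTE xy) mulr0.
Qed.

Lemma mul_gring_mx (u v : 'rV[F]_#|G|) :
  u *m gring_mx aG v = \sum_x v 0 (gring_index G x) *: (u *m aG x).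
Proof. by rewrite gring_mxE mulmx_sumr; apply: eq_bigr => x _; rewrite scalemxAr. Qed.

(* Left multiplication by u; the regular representation acts on the right. *)
Definition lreg (u : 'rV[F]_#|G|) : 'M[F]_#|G| :=
  \matrix_i (u *m aG (enum_val i)).

Lemma row_mul_lreg m (v : 'M[F]_(m, #|G|)) u i :
  row i (v *m lreg u) = u *m gring_mx aG (row i v).
Proof.
rewrite row_mul mulmx_sum_row mul_gring_mx (reindex (gring_index G)) /=.
  by apply: eq_bigr => x _; rewrite rowK gring_indexK ?inE.
exists enum_val => [x _|j _]; first by rewrite gring_indexK ?inE.
by rewrite gring_valK.
Qed.

Lemma gring_mx_mul (u : 'rV[F]_#|G|) x :
  gring_mx aG (u *m aG x) = gring_mx aG u *m aG x.
Proof. by rewrite gring_mxJ ?inE. Qed.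

Lemma lreg_comm u x : lreg u *m aG x = aG x *m lreg u.
Proof.
apply/row_matrixP=> i; rewrite row_mul_lreg row_mul rowK -mulmxA -regM rowK.
by rewrite gring_mx_delta.
Qed.

Lemma lreg_mul (u v : 'rV[F]_#|G|) : lreg v *m lreg u = lreg (u *m gring_mx aG v).
Proof.
apply/row_matrixP=> i; rewrite row_mul_lreg !rowK gring_mx_mul.
by rewrite mulmxA.
Qed.

Lemma lreg_cyclic u : (lreg u :=: cyclic_mx aG u)%MS.
Proof.
apply/eqmxP/andP; split.
  apply/row_subP=> i; rewrite rowK; apply/cyclic_mxP; exists (aG (enum_val i)) => //.
  by rewrite envelop_mx_id ?inE.
apply: cyclic_mx_sub.
  apply/mxmoduleP => x _; rewrite lreg_comm submxMl //.
have {1}<- : row (gring_index G 1) (lreg u) = u.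
  by rewrite rowK gring_indexK ?inE // repr_mx1 mulmx1.
exact: row_sub.
Qed.

Lemma mxtrace_cyclic_reg u (m : F) s :
  let c := gring_mx aG u in
  [pchar F] =i pred0 -> c *m c = m *: c -> m != 0 ->
  \tr (submod_repr (cyclic_mx_module aG u) s)
    = (m * #|G|%:R)^-1 * \sum_x \tr (c *m (aG x *m aG s *m aG x^-1%g)).
Proof.
move=> c charF cc m0.
have G0 : #|G|%:R != 0 :> F by rewrite ((pcharf0P F).1 charF) -lt0n cardG_gt0.
have uc : u *m c = m *: u.
  have := congr1 (@gring_row F _ G) cc.
  by rewrite gring_row_mul linearZ /= gring_mxK.
rewrite (mxtrace_submod_idem (P := m^-1 *: lreg u)) ?inE //; first last.
- by apply: eqmx_trans (eqmx_scale _ _) (lreg_cyclic u); rewrite invr_eq0.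
- by rewrite -scalemxAl -scalemxAr lreg_comm.
- rewrite -scalemxAl -scalemxAr lreg_mul -/c uc.
  have -> : lreg (m *: u) = m *: lreg u.
    by apply/row_matrixP=> i; rewrite linearZ /= !rowK -scalemxAl.
  by rewrite !scalerA mulfVK.
rewrite -scalemxAl mxtraceZ invfM -mulrA; congr (_ * _).
rewrite mulr_sumr /mxtrace (reindex (gring_index G)) /=; last first.
  by exists enum_val => [x _|i _]; rewrite ?gring_valK // gring_indexK ?inE.
apply: eq_bigr => x _.
(* The diagonal entry at [x] is the coefficient of [x] in [u x s]; [gring_coef] writes it as a
   trace, at the cost of the factor [#|G|]. *)
have -> : (lreg u *m regular_mx F G s) (gring_index G x) (gring_index G x)
   = (u *m aG x *m aG s) 0 (gring_index G x).
  have <- : row (gring_index G x) (lreg u *m aG s) = u *m aG x *m aG s.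
    by rewrite row_mul rowK gring_indexK ?inE.
  by rewrite [RHS]mxE.
apply: (mulfI G0); rewrite mulrA mulfV // mul1r -gring_coef !gring_mx_mul.
by rewrite -!mulmxA.
Qed.

Lemma sum_trace_reg (A : 'M[F]_#|G|) : (A \in enveloping_algebra_mx aG)%MS ->
  \sum_x \tr (A *m aG x^-1%g) *: aG x = #|G|%:R *: A.
Proof.
case/envelop_mxP => a ->; rewrite scaler_sumr.
rewrite [RHS](eq_bigl predT) => [|x]; last by rewrite inE.
apply: eq_bigr => x _.
rewrite scalerA; congr (_ *: _).
rewrite mulmx_suml linear_sum /= (bigD1 x) ?inE //= big1 ?addr0.
  by rewrite -scalemxAl mxtraceZ regKV mxtrace1 mulrC.
move=> y /andP[_ xy]; rewrite -scalemxAl -regM mxtraceZ mxtrace_reg.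
by rewrite -(inj_eq (mulIg x)) mulgKV mul1g (negbTE xy) mulr0.
Qed.

Lemma sum_trace_mul (A B : 'M[F]_#|G|) : (A \in enveloping_algebra_mx aG)%MS ->
  \sum_x \tr (A *m aG x) * \tr (B *m aG x^-1%g) = #|G|%:R * \tr (A *m B).
Proof.
move=> EA; rewrite -mxtraceZ scalemxAl -sum_trace_reg // mulmx_suml linear_sum /=.
rewrite (reindex_inj invg_inj) /=; apply: eq_bigr => x _.
by rewrite -scalemxAl mxtraceZ invgK (mxtrace_mulC B).
Qed.

(* Up to a scalar, the character of the right ideal generated by A when A is
   proportional to an idempotent; cdot is the inner product of two such. *)
Definition ctr (A : 'M[F]_#|G|) s := \sum_x \tr (A *m (aG x *m aG s *m aG x^-1%g)).

Definition cdot (A B : 'M[F]_#|G|) :=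
  \sum_x \tr (A *m (aG x *m B *m aG x^-1%g)).

Lemma cdotC A B : cdot A B = cdot B A.
Proof.
rewrite /cdot (reindex_inj invg_inj) /=; apply: eq_bigr => x _.
by rewrite invgK !mulmxA mxtrace_mulC !mulmxA mxtrace_mulC !mulmxA.
Qed.

(** For fixed conjugators [x] and [y], [sum_trace_mul] collapses the sum over [s] and leaves [B]
    conjugated by [x * y^-1]; each of the two remaining redundancies costs a factor [#|G|]. *)
Lemma ctr_dot A B : (A \in enveloping_algebra_mx aG)%MS ->
  \sum_s ctr A s * ctr B s^-1%g = #|G|%:R ^+ 2 * cdot A B.
Proof.
move=> EA; under eq_bigr => s _ do rewrite mulr_suml.
rewrite exchange_big /=.
under eq_bigr => x _ do under eq_bigr => s _ do rewrite mulr_sumr.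
under eq_bigr => x _ do rewrite exchange_big /=.
have H x y : \sum_s \tr (A *m (aG x *m aG s *m aG x^-1%g)) *
   \tr (B *m (aG y *m aG s^-1%g *m aG y^-1%g)) =
   #|G|%:R * \tr (A *m (aG (x * y^-1)%g *m B *m aG (x * y^-1)^-1%g)).
  rewrite -mulmxA -sum_trace_mul // (reindex_inj (conjg_inj x)); cbv beta.
  apply: eq_bigr => s _; congr (_ * _).
    by rewrite -!regM conjgE !mulgA mulgV mul1g mulgK.
  rewrite -[in RHS]mulmxA -[in RHS]mulmxA [RHS]mxtrace_mulC -!mulmxA -!regM.
  by congr (\tr (_ *m aG _)); rewrite conjgE !invMg !invgK !mulgA.
under eq_bigr => x _ do under eq_bigr => y _ do rewrite H.
rewrite exchange_big.
have E y : \sum_x #|G|%:R *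
    \tr (A *m (aG (x * y^-1)%g *m B *m aG (x * y^-1)^-1%g)) = #|G|%:R * cdot A B.
  by rewrite -mulr_sumr /cdot [in RHS](reindex_inj (mulIg y^-1%g)).
transitivity (\sum_(y : gT) #|G|%:R * cdot A B).
  by apply: eq_bigr => y _; apply: E.
by rewrite sumr_const -[LHS]mulr_natl -cardsT mulrA -expr2.
Qed.

End Regular.

Arguments regular_repr : simpl never.

(** * Young symmetrizers *)

Section TransposeSum.
Variables (R : pzRingType) (m n : nat).

Lemma trmx_sum (I : Type) (r : seq I) (P : pred I) (A : I -> 'M[R]_(m, n)) :
  (\sum_(i <- r | P i) A i)^T = \sum_(i <- r | P i) (A i)^T.
Proof. by rewrite linear_sum. Qed.

Lemma trmxZ a (A : 'M[R]_(m, n)) : (a *: A)^T = a *: A^T.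
Proof. by rewrite linearZ. Qed.

Lemma mxtrace_sum (I : Type) (r : seq I) (P : pred I) (A : I -> 'M[R]_n) :
  \tr (\sum_(i <- r | P i) A i) = \sum_(i <- r | P i) \tr (A i).
Proof. by rewrite linear_sum. Qed.

End TransposeSum.

Lemma scaler_cancel (F : fieldType) (V : lmodType F) (v : V) (a b : F) :
  v != 0 -> a *: v = b *: v -> a = b.
Proof.
move=> v0 /eqP; rewrite -subr_eq0 -scalerBl scaler_eq0 (negbTE v0) orbF subr_eq0.
by move/eqP.
Qed.

Section Young.
Variables (F : numFieldType) (n : nat).
Implicit Types la mu : part n.
Let G : {group 'S_n} := [set: 'S_n]%G.
Let aG := regular_repr F G.

Definition rsym la : 'M[F]_#|G| := \sum_(p in row_stab la) aG p.
Definition csym la : 'M[F]_#|G| :=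
  \sum_(q in col_stab la) (-1) ^+ odd_perm q *: aG q.
Definition ysym la := rsym la *m csym la.

Lemma gring_young la : gring_mx aG (young_symmetrizer F la) = ysym la.
Proof.
rewrite /young_symmetrizer linear_sum /ysym {1}/rsym mulmx_suml; apply: eq_bigr => p _.
rewrite linear_sum /csym mulmx_sumr; apply: eq_bigr => q _.
by rewrite linearZ /= gring_mx_delta -scalemxAr -regM.
Qed.

Lemma mul_reg_rsym la p : p \in row_stab la -> aG p *m rsym la = rsym la.
Proof.
move=> Rp; rewrite /rsym mulmx_sumr [RHS](reindex_inj (mulgI p)).
apply: eq_big => q; last by rewrite regM.
apply/idP/idP => Rq; first exact: row_stabM.
by rewrite -(mulKg p q) row_stabM // row_stabV.
Qed.

Lemma mul_rsym_reg la p : p \in row_stab la -> rsym la *m aG p = rsym la.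
Proof.
move=> Rp; rewrite /rsym mulmx_suml [RHS](reindex_inj (mulIg p)).
apply: eq_big => q; last by rewrite regM.
apply/idP/idP => Rq; first exact: row_stabM.
by rewrite -(mulgK p q) row_stabM // row_stabV.
Qed.

Lemma mul_reg_csym la p : p \in col_stab la ->
  aG p *m csym la = (-1) ^+ odd_perm p *: csym la.
Proof.
move=> Rp; rewrite /csym mulmx_sumr [in RHS](reindex_inj (mulgI p)) scaler_sumr.
apply: eq_big => q; last first.
  by move=> _; rewrite regM scalerA -signr_addb odd_permM addbA addbb addFb scalemxAr.
apply/idP/idP => Rq; first exact: col_stabM.
by rewrite -(mulKg p q) col_stabM // col_stabV.
Qed.

Lemma rsym_sqr la : rsym la *m rsym la = #|row_stab la|%:R *: rsym la.
Proof.
rewrite {1}/rsym mulmx_suml (eq_bigr (fun=> rsym la)).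
  by rewrite sumr_const scaler_nat.
by move=> p Rp; apply: mul_reg_rsym.
Qed.

(** Transposition realizes the anti-automorphism inverting group elements. It fixes [rsym] and
    [csym], and so exchanges statements on [rsym x csym] and on [csym x rsym]. *)
Lemma regT x : (aG x)^T = aG x^-1%g.
Proof.
apply/matrixP=> i j; rewrite !mxE !eqxx /=.
rewrite -(inj_eq (can_inj (@gring_valK _ G))) -[in RHS](inj_eq (can_inj
  (@gring_valK _ G))).
rewrite !gring_indexK ?inE // -(inj_eq (mulIg x) (enum_val j)) mulgKV.
by rewrite eq_sym.
Qed.

Lemma rsymT la : (rsym la)^T = rsym la.
Proof.
rewrite [in LHS]/rsym trmx_sum /rsym (reindex_inj invg_inj).
by apply: eq_big => p; rewrite ?row_stabV // => _; rewrite regT invgK.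
Qed.

Lemma csymT la : (csym la)^T = csym la.
Proof.
rewrite [in LHS]/csym trmx_sum /csym (reindex_inj invg_inj).
apply: eq_big => p; rewrite ?col_stabV // => _.
by rewrite trmxZ odd_permV regT invgK.
Qed.

(** [rsym] absorbs [t], while [csym] absorbs its conjugate with sign -1, so the product equals its
    own negative. *)
Lemma rsym_odd_csym_eq0 mu la x t : t \in row_stab mu ->
  (t ^ x)%g \in col_stab la -> odd_perm t -> rsym mu *m aG x *m csym la = 0.
Proof.
move=> Rt Ct ot.
have e : rsym mu *m aG x *m csym la = - (rsym mu *m aG x *m csym la).
  rewrite -{1}(mul_rsym_reg Rt) -mulmxA -[rsym mu *m aG t *m _]mulmxA.
  rewrite [aG t *m _]mulmxA -regM conjgC regM -[aG x *m _ *m _]mulmxA.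
  by rewrite mul_reg_csym // odd_permJ ot expr1 scaleN1r !mulmxN mulmxA.
move/eqP: e; rewrite -addr_eq0 -mulr2n -scaler_nat scaler_eq0 pnatr_eq0 /=.
by move/eqP.
Qed.

Lemma rsym_reg_csym_eq0 mu la x : (weight la <= weight mu)%N -> mu != la ->
  rsym mu *m aG x *m csym la = 0.
Proof.
move=> lew /eqP ne; have [[t Rt [Ct ot]]|[h1 h2]] := row_col_cases mu la x.
  exact: rsym_odd_csym_eq0 Rt Ct ot.
by case: ne; apply: (h2 _).1; lia.
Qed.

Lemma rsym_reg_csym la x : exists k, rsym la *m aG x *m csym la = k *: ysym la.
Proof.
have [[t Rt [Ct ot]]|[_ h2]] := row_col_cases la la x.
  by exists 0; rewrite scale0r (rsym_odd_csym_eq0 Rt Ct ot).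
have [_ [p [q [Rp Cq ->]]]] := h2 erefl; exists ((-1) ^+ odd_perm q).
by rewrite regM mulmxA mul_rsym_reg // -mulmxA mul_reg_csym // -scalemxAr.
Qed.

Lemma csym_reg_rsym_eq0 mu la x : (weight la <= weight mu)%N -> mu != la ->
  csym la *m aG x *m rsym mu = 0.
Proof.
move=> lew ne; apply: trmx_inj; rewrite !trmx_mul rsymT csymT regT trmx0 mulmxA.
exact: rsym_reg_csym_eq0.
Qed.

Lemma csym_reg_rsym la x :
  exists k, csym la *m aG x *m rsym la = k *: (csym la *m rsym la).
Proof.
have [k e] := rsym_reg_csym la x^-1%g; exists k; apply: trmx_inj.
by rewrite trmxZ !trmx_mul rsymT csymT regT mulmxA e.
Qed.

Lemma rsym_envelop la : (rsym la \in enveloping_algebra_mx aG)%MS.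
Proof.
rewrite /rsym linear_sum; apply: summx_sub => p _.
by rewrite envelop_mx_id ?inE.
Qed.

Lemma csym_envelop la : (csym la \in enveloping_algebra_mx aG)%MS.
Proof.
rewrite /csym linear_sum; apply: summx_sub => p _.
by rewrite linearZ scalemx_sub // envelop_mx_id ?inE.
Qed.

Lemma ysym_envelop la : (ysym la \in enveloping_algebra_mx aG)%MS.
Proof. by rewrite envelop_mxM ?rsym_envelop ?csym_envelop. Qed.

Lemma rsym_mul_csym la A : (A \in enveloping_algebra_mx aG)%MS ->
  exists k, rsym la *m A *m csym la = k *: ysym la.
Proof.
case/envelop_mxP=> a ->; have [k kP] := fin_all_exists (rsym_reg_csym la).
exists (\sum_(x in G) a x * k x); rewrite [rsym la *m _]mulmx_sumr mulmx_suml scaler_suml.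
by apply: eq_bigr => x _; rewrite -scalemxAr -scalemxAl kP scalerA.
Qed.

(** Only pairs with [p * q = 1] contribute, and then [p] lies in both groups, so it is 1: the Young
    symmetrizer has coefficient 1 at the identity. *)
Lemma mxtrace_ysym la : \tr (ysym la) = #|G|%:R.
Proof.
have E p q : p \in row_stab la -> q \in col_stab la ->
    \tr (aG p *m ((-1) ^+ odd_perm q *: aG q)) = if (p == 1%g) && (q == 1%g) then
      #|G|%:R else 0 :> F.
  move=> Rp Cq; rewrite -scalemxAr mxtraceZ -regM mxtrace_reg.
  case: (eqVneq p 1%g) => [->|p1]; rewrite ?mul1g.
    by case: eqP => [->|_]; rewrite ?mulr0 // odd_perm1 mul1r.
  case: eqP; rewrite ?mulr0 // => e.
  case/eqP: p1; apply: row_col_stab1 Rp _; rewrite -(col_stabV la).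
  by rewrite (_ : p^-1 = q)%g //; apply: (mulgI p); rewrite e mulgV.
rewrite /ysym {1}/rsym mulmx_suml mxtrace_sum (bigD1 1%g) ?row_stab1 //=.
rewrite [X in _ + X]big1 => [|p /andP[Rp p1]]; last first.
  rewrite /csym mulmx_sumr mxtrace_sum big1 // => q Cq.
  by rewrite E // (negbTE p1).
rewrite addr0 /csym mulmx_sumr mxtrace_sum (bigD1 1%g) ?col_stab1 //=.
rewrite [X in _ + X]big1 => [|p /andP[Rp p1]]; last first.
  by rewrite E ?row_stab1 // (negbTE p1) andbF.
by rewrite addr0 E ?row_stab1 ?col_stab1 // !eqxx.
Qed.

Lemma card_neq0 : #|G|%:R != 0 :> F.
Proof. by rewrite pnatr_eq0 -lt0n cardG_gt0. Qed.

Lemma ysym_neq0 la : ysym la != 0.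
Proof.
by apply: contraTneq card_neq0 => e; rewrite -(mxtrace_ysym la) e mxtrace0 eqxx.
Qed.

(** If [m] were 0, the symmetrizer would square to 0 and have trace 0. *)
Lemma ysym_sqr la : exists2 m, m != 0 & ysym la *m ysym la = m *: ysym la.
Proof.
have [] := @rsym_mul_csym la (csym la *m rsym la).
  by rewrite envelop_mxM ?rsym_envelop ?csym_envelop.
move=> m; rewrite mulmxA -mulmxA -/(ysym la) => e; exists m => //.
apply: contraTneq card_neq0 => m0; rewrite -(mxtrace_ysym la) mxtrace_sqr0 ?eqxx //.
by rewrite e m0 scale0r.
Qed.

Lemma cdot_ysym_neq la mu : la != mu -> cdot (ysym la) (ysym mu) = 0.
Proof.
wlog lew : la mu / (weight la <= weight mu)%N => [H|ne].
  case/orP: (leq_total (weight la) (weight mu)) => h ne; first exact: H.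
  by rewrite cdotC H // eq_sym.
rewrite /cdot big1 // => x _.
have -> : ysym la *m (aG x *m ysym mu *m aG x^-1%g) =
    rsym la *m (csym la *m aG x *m rsym mu) *m (csym mu *m aG x^-1%g).
  by rewrite /ysym !mulmxA.
by rewrite csym_reg_rsym_eq0 1?eq_sym // mulmx0 mul0mx mxtrace0.
Qed.

Lemma cdot_ysym_rsym_eq0 la mu : (weight la <= weight mu)%N -> la != mu ->
  cdot (ysym la) (rsym mu) = 0.
Proof.
move=> lew ne; rewrite /cdot big1 // => x _.
have -> : ysym la *m (aG x *m rsym mu *m aG x^-1%g) =
    rsym la *m (csym la *m aG x *m rsym mu) *m aG x^-1%g.
  by rewrite /ysym !mulmxA.
by rewrite csym_reg_rsym_eq0 1?eq_sym // mulmx0 mul0mx mxtrace0.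
Qed.

(** With [c x c = k x c], the sum of the [k x * \tr (c x^-1)] is found by multiplying it by [c]:
    Fourier inversion ([sum_trace_reg]) yields [#|G| c^3], which is [#|G| m^2 c]. *)
Lemma cdot_ysym la m : ysym la *m ysym la = m *: ysym la ->
  cdot (ysym la) (ysym la) = #|G|%:R * m ^+ 2.
Proof.
move=> cc; set c := ysym la in cc *.
have /fin_all_exists[k kP] : forall x, exists k, c *m aG x *m c = k *: c.
  move=> x; have [] := @rsym_mul_csym la (csym la *m aG x *m rsym la).
    by rewrite !envelop_mxM ?rsym_envelop ?csym_envelop ?envelop_mx_id ?inE.
  by move=> k e; exists k; rewrite -e /c /ysym !mulmxA.
have -> : cdot c c = \sum_x k x * \tr (c *m aG x^-1%g).
  by apply: eq_bigr => x _; rewrite 2!mulmxA kP -scalemxAl mxtraceZ.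
apply: (scaler_cancel (ysym_neq0 la)); rewrite -/c scaler_suml.
under eq_bigr => x _ do rewrite mulrC -scalerA -kP scalemxAl scalemxAr.
rewrite -mulmx_suml -mulmx_sumr sum_trace_reg ?ysym_envelop //.
by rewrite -scalemxAr cc -scalemxAl -scalemxAl cc !scalerA expr2 mulrA.
Qed.

(** The same device with [d = csym *m rsym], the transpose of [ysym], which has the same scalar [m];
    the repeated [rsym] yields the order of the row group. *)
Lemma cdot_ysym_rsym la m : ysym la *m ysym la = m *: ysym la ->
  cdot (ysym la) (rsym la) = #|G|%:R * #|row_stab la|%:R * m.
Proof.
move=> cc; pose d := csym la *m rsym la.
have dE : d = (ysym la)^T by rewrite trmx_mul rsymT csymT.
have dd : d *m d = m *: d by rewrite dE -trmx_mul cc trmxZ.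
have d0 : d != 0 by rewrite dE trmx_eq0 ysym_neq0.
have /fin_all_exists[k kP] := csym_reg_rsym la.
have -> : cdot (ysym la) (rsym la) = \sum_x k x * \tr (rsym la *m d *m aG x^-1%g).
  apply: eq_bigr => x _.
  have -> : ysym la *m (aG x *m rsym la *m aG x^-1%g) =
      rsym la *m (csym la *m aG x *m rsym la) *m aG x^-1%g.
    by rewrite /ysym !mulmxA.
  by rewrite kP -scalemxAr -scalemxAl mxtraceZ.
apply: (scaler_cancel d0); rewrite scaler_suml.
under eq_bigr => x _ do rewrite mulrC -scalerA -kP scalemxAl scalemxAr.
rewrite -mulmx_suml -mulmx_sumr sum_trace_reg; last first.
  by rewrite !envelop_mxM ?rsym_envelop ?csym_envelop.
have -> : csym la *m (#|G|%:R *: (rsym la *m d)) *m rsym la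
    = #|G|%:R *: (d *m csym la *m (rsym la *m rsym la)).
  by rewrite -scalemxAr -scalemxAl !mulmxA.
by rewrite rsym_sqr -scalemxAr -mulmxA -/d dd !scalerA.
Qed.
End Young.

(** * Orthogonality of the Specht characters *)

Section Characters.
Variables (F : numFieldType) (n : nat).
Implicit Types (la mu : part n) (f g : 'S_n -> F).
Let G : {group 'S_n} := [set: 'S_n]%G.
Let aG := regular_repr F G.

(** Bilinear, so that it makes sense over any [numFieldType]; it agrees with the Hermitian form on
    real functions. *)
Definition dot f g : F := n`!%:R^-1 * \sum_s f s * g s.

Lemma fact_neq0 : n`!%:R != 0 :> F.
Proof. by rewrite pnatr_eq0 -lt0n fact_gt0. Qed.

Lemma cardS : #|G| = n`!.
Proof. by rewrite cardsT card_Sn. Qed.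

Lemma ctr_mulC (A : 'M[F]_#|G|) x s : ctr (aG x *m A) s = ctr (A *m aG x) s.
Proof.
rewrite /ctr [in RHS](reindex_inj (mulgI x^-1%g)); apply: eq_bigr => y _.
rewrite -[aG x *m A *m _]mulmxA [LHS]mxtrace_mulC -!regM -[in LHS]mulmxA -[in
  RHS]mulmxA -!regM.
by congr (\tr (_ *m aG _)); rewrite invMg invgK !mulgA mulgV mul1g.
Qed.

Lemma ctrD I (r : seq I) (P : pred I) (A : I -> 'M[F]_#|G|) s :
  ctr (\sum_(i <- r | P i) A i) s = \sum_(i <- r | P i) ctr (A i) s.
Proof.
rewrite exchange_big; apply: eq_bigr => x _.
by rewrite mulmx_suml mxtrace_sum.
Qed.

Lemma ctrT (A : 'M[F]_#|G|) s : ctr A^T s = ctr A s^-1%g.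
Proof.
apply: eq_bigr => x _; rewrite -mxtrace_tr trmx_mul trmxK mxtrace_mulC.
by rewrite !trmx_mul !regT invgK !mulmxA.
Qed.

(** Transposition inverts [s] and swaps the two factors of [ysym], and [ctr] is insensitive to the
    swap. This reconciles the inverse in [ctr_dot] with [dot]. *)
Lemma ctr_ysymV la s : ctr (ysym F la) s^-1%g = ctr (ysym F la) s.
Proof.
rewrite -ctrT /ysym trmx_mul rsymT csymT.
rewrite [csym F la *m _]mulmx_sumr {1}/rsym mulmx_suml !ctrD.
by apply: eq_bigr => p _; rewrite ctr_mulC.
Qed.

Lemma ctr_rsym mu s :
  ctr (rsym F mu) s = n`!%:R * \sum_x ((s ^ x)%g \in row_stab mu)%:R.
Proof.
rewrite /ctr (reindex_inj invg_inj) mulr_sumr; apply: eq_bigr => x _.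
rewrite invgK -!regM (_ : (_ * _)%g = (s ^ x)%g); last by rewrite conjgE ?mulgA.
rewrite mulmx_suml mxtrace_sum -cardS.
case: (boolP (_ \in _)) => [Rs|nRs].
  rewrite (bigD1 (s ^ x)^-1%g) ?row_stabV //= -regM mulVg mxtrace_reg eqxx mulr1.
  rewrite big1 ?addr0 // => p /andP[Rp np]; rewrite -regM mxtrace_reg; case: eqP => // e.
  by case/eqP: np; apply: (mulIg (s ^ x)%g); rewrite e mulVg.
rewrite mulr0 big1 // => p Rp; rewrite -regM mxtrace_reg; case: eqP => // e.
case/negP: nRs; rewrite -row_stabV (_ : _^-1 = p)%g //.
by apply: (mulIg (s ^ x)%g); rewrite e mulVg.
Qed.

Definition row_word mu : {ffun 'I_n -> 'I_(size (parts mu))} :=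
  [ffun i => cast_ord (esym (size_parts mu)) (Ordinal (row_of_lt mu i))].

Lemma wcount_row_word mu j : wcount (row_word mu) j = nth 0%N (parts mu) j.
Proof.
by rewrite -card_row; apply: eq_card => i; rewrite !inE ffunE -val_eqE.
Qed.

Lemma wstab_row_word mu : wstab (row_word mu) = row_stab mu.
Proof.
apply/setP=> s; rewrite !inE; apply/forallP/forallP => h i; have := h i;
  by rewrite !ffunE -val_eqE.
Qed.

Lemma word_fix_parts mu s :
  (#|row_stab mu| * word_fix (parts mu) s = \sum_x ((s ^ x)%g \in row_stab mu))%N.
Proof.
have -> : word_fix (parts mu) s = (\sum_(h in wclass (row_word mu)) wfix h s)%N.
  rewrite /word_fix -sum1_card.
  rewrite [LHS](eq_bigl (fun h => (h \in wclass (row_word mu)) && wfix h s)) => [|h].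
    by rewrite big_mkcondr; apply: eq_bigr => h _; case: wfix.
  rewrite !inE; congr (_ && _); apply: eq_forallb => j.
  by rewrite wcount_row_word.
rewrite -(wstab_row_word mu) -sum_wcomp; apply: eq_bigr => x _.
by rewrite wfix_comp.
Qed.

(** Both sides are the character induced from the trivial character of the row group, which is the
    stabilizer of [row_word mu]. *)
Lemma word_fix_ctr mu s :
  (word_fix (parts mu) s)%:R = (#|row_stab mu|%:R * n`!%:R)^-1 * ctr (rsym F mu) s.
Proof.
have R0 : #|row_stab mu|%:R != 0 :> F.
  by rewrite pnatr_eq0 -wstab_row_word -lt0n wstab_gt0.
apply: (mulfI R0); rewrite -[LHS]natrM word_fix_parts ctr_rsym natr_sum invfM.
by rewrite !mulrA mulfV // mul1r mulVf ?fact_neq0 // mul1r.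
Qed.

Lemma specht_charE la : exists m, [/\ m != 0, ysym F la *m ysym F la = m *: ysym F la
  & forall s, specht_char F la s = (m * n`!%:R)^-1 * ctr (ysym F la) s].
Proof.
have [m m0 cc] := ysym_sqr F la; exists m; split=> // s.
rewrite /specht_char /specht (mxtrace_cyclic_reg _ (m := m)) ?gring_young //.
  by rewrite -cardS.
exact: Num.Theory.pchar_num.
Qed.

Lemma dot_specht la mu :
  dot (specht_char F la) (specht_char F mu) = (la == mu)%:R.
Proof.
have [m [m0 cc e]] := specht_charE la; have [m' [m0' cc' e']] := specht_charE mu.
have D : dot (specht_char F la) (specht_char F mu) =
    n`!%:R^-1 * ((m * n`!%:R)^-1 * (m' * n`!%:R)^-1 * (n`!%:R ^+ 2 * cdot (ysym F
      la) (ysym F mu))).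
  rewrite -[in X in X ^+ 2]cardS -ctr_dot ?ysym_envelop // mulr_sumr.
  congr (_ * _); apply: eq_bigr => s _.
  by rewrite e e' ctr_ysymV; ring.
rewrite D; case: (eqVneq la mu) => [elm|ne]; last by rewrite cdot_ysym_neq // !mulr0.
subst mu; rewrite (cdot_ysym cc) cardS.
have emm : m' = m by apply: (scaler_cancel (ysym_neq0 F la)); rewrite -cc -cc'.
by rewrite emm /=; move: fact_neq0; set N := n`!%:R => N0; field; rewrite N0 m0.
Qed.

Lemma dot_word_fix la mu :
  (weight la <= weight mu)%N ->
  dot (fun s => (word_fix (parts mu) s)%:R) (specht_char F la) = (la == mu)%:R.
Proof.
move=> lew; have [m [m0 cc e]] := specht_charE la.
have R0 : #|row_stab mu|%:R != 0 :> F.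
  by rewrite pnatr_eq0 -wstab_row_word -lt0n wstab_gt0.
have D : dot (fun s => (word_fix (parts mu) s)%:R) (specht_char F la) =
    n`!%:R^-1 * ((#|row_stab mu|%:R * n`!%:R)^-1 * (m * n`!%:R)^-1 * (n`!%:R ^+ 2
      * cdot (rsym F mu) (ysym F la))).
  rewrite -[in X in X ^+ 2]cardS -ctr_dot ?rsym_envelop // mulr_sumr.
  congr (_ * _); apply: eq_bigr => s _.
  by rewrite e word_fix_ctr ctr_ysymV; ring.
rewrite D cdotC; case: (eqVneq la mu) => [elm|ne]; last by rewrite
  cdot_ysym_rsym_eq0 // !mulr0.
subst mu; rewrite (cdot_ysym_rsym cc) cardS.
rewrite /=; move: fact_neq0 R0; set N := n`!%:R; set M := _%:R => N0 M0.
by field; rewrite N0 m0 M0.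
Qed.

Lemma reg_real x : aG x \is a mxOver Num.real.
Proof. by apply/mxOverP=> i j; rewrite !mxE realn. Qed.

Lemma ysym_real la : ysym F la \is a mxOver Num.real.
Proof.
apply: mxOverM; apply: rpred_sum => p _; first exact: reg_real.
by apply: mxOverZ (reg_real p); rewrite rpredX // rpredN rpred1.
Qed.

Lemma mxtrace_real m (A : 'M[F]_m) : A \is a mxOver Num.real -> \tr A \is Num.real.
Proof. by move=> /mxOverP h; apply: rpred_sum. Qed.

Lemma specht_char_real la s : specht_char F la s \is Num.real.
Proof.
have [m [m0 cc ->]] := specht_charE la.
(* As a quotient of traces of real matrices, [m] is real. *)
have mE : m = (\tr (ysym F la *m ysym F la)) / \tr (ysym F la).
  by rewrite cc mxtraceZ mxtrace_ysym mulfK // cardS fact_neq0.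
have Em : m \is Num.real.
  rewrite mE; apply: rpred_div; apply: mxtrace_real; last exact: ysym_real.
  by apply: mxOverM; apply: ysym_real.
rewrite rpredM ?rpredV ?rpredM ?realn //; apply: rpred_sum => x _.
apply: mxtrace_real; apply: mxOverM; first exact: ysym_real.
by do ?apply: mxOverM; apply: reg_real.
Qed.

End Characters.

(** * Young's rule *)

Section YoungRule.
Variables (F : numFieldType) (n : nat).
Implicit Types (la mu nu : part n) (a b : seq nat) (f g : 'S_n -> F).

Local Notation wf a := (fun s : 'S_n => (word_fix a s)%:R : F).
Local Notation chi la := (specht_char F la).
Local Notation kk := gelfand_tsetlin.

Lemma dotC f g : dot f g = dot g f.
Proof. by congr (_ * _); apply: eq_bigr => s _; rewrite mulrC. Qed.

Lemma dot_sumr I (r : seq I) (P : pred I) (k : I -> F) f (g : I -> 'S_n -> F) :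
  dot f (fun s => \sum_(i <- r | P i) k i * g i s)
    = \sum_(i <- r | P i) k i * dot f (g i).
Proof.
rewrite /dot; under eq_bigr => s _ do rewrite mulr_sumr.
rewrite exchange_big mulr_sumr; apply: eq_bigr => i _ /=.
rewrite mulrCA [in RHS]mulr_sumr; congr (_ * _).
by apply: eq_bigr => s _; rewrite mulrCA.
Qed.

Lemma dotBr f g h : dot f (fun s => g s - h s) = dot f g - dot f h.
Proof.
rewrite /dot -mulrBr -sumrB; congr (_ * _).
by apply: eq_bigr => s _; rewrite mulrBr.
Qed.

Lemma eq_dotr f g h : g =1 h -> dot f g = dot f h.
Proof. by move=> e; congr (_ * _); apply: eq_bigr => s _; rewrite e. Qed.

Lemma dot_self_eq0 f : (forall s, f s \is Num.real) -> dot f f = 0 -> forall s, f s = 0.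
Proof.
move=> fr /eqP; rewrite mulf_eq0 invr_eq0 (negbTE (fact_neq0 F n)) /=.
have ge0 s : true -> 0 <= f s * f s by rewrite -expr2 real_exprn_even_ge0.
rewrite psumr_eq0 // => /allP h s; have /implyP/(_ isT) := h s (mem_index_enum s).
by rewrite mulf_eq0 orbb => /eqP.
Qed.

(** [parts nu], of length [n], takes the slot of [sum_nchains2] with a length bound; [a] may be
    longer, as (0, 1^n) is. *)
Lemma dot_word_fix2 a nu : sumn a = n ->
  dot (wf a) (wf (parts nu)) = \sum_(la : part n) (kk la a * kk la (parts nu))%:R.
Proof.
move=> sa; have sn := sumn_parts nu.
rewrite -natr_sum -(sum_nchains_part (fun l => nchains l (rev a))) ?sumn_rev //.
rewrite sum_nchains2 ?size_rev ?size_parts ?sumn_rev ?sa //.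
apply: (mulfI (fact_neq0 F n)); rewrite mulrA mulfV ?fact_neq0 // mul1r -natrM.
rewrite -(sum_word_fix2 (n := n)) ?sumn_rev // natr_sum.
by apply: eq_bigr => s _; rewrite !word_fix_rev natrM.
Qed.

(** Expand the character of content [parts la] and compare with [dot_word_fix2]: other shapes of
    weight at most [weight la] drop out by triangularity, those of larger weight agree by induction,
    and the coefficient at [la] is 1. *)
Lemma dot_word_fix_above w :
  (forall nu, (w <= weight nu)%N ->
     forall s, (word_fix (parts nu) s)%:R = \sum_(la : part n) (kk la (parts
       nu))%:R * chi la s) ->
  forall a la, sumn a = n -> (w <= weight la)%N -> dot (wf a) (chi la) = (kk la a)%:R.
Proof.
(* Downward induction on the weight; the total of all weights is merely a convenient upper bound. *)
move=> Pw a la sa; have [N] := ubnP (\sum_(nu : part n) weight nu - weight la)%N.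
elim: N la => // N IH la; rewrite ltnS => leN wla.
have := dot_word_fix2 la sa; rewrite (eq_dotr _ (Pw la wla)) dot_sumr.
rewrite (bigD1 la) //= [in RHS](bigD1 la) //= gelfand_tsetlin_diag mul1r muln1.
rewrite (eq_bigr (fun k => (kk k a * kk k (parts la))%:R)) => [|k kla].
  by move/addIr.
rewrite natrM mulrC; case: (leqP (weight k) (weight la)) => h.
  by rewrite gelfand_tsetlin_eq0 // !mulr0.
have wk : (weight k <= \sum_(nu : part n) weight nu)%N by rewrite (bigD1 k) //= leq_addr.
by rewrite IH //; lia.
Qed.

(* The residual of the expansion has norm 0, so completeness of the Specht
   characters is not needed. *)
Lemma word_fix_expansion nu s :
  (word_fix (parts nu) s)%:R = \sum_(la : part n) (kk la (parts nu))%:R * chi la s.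
Proof.
have [N] := ubnP (\sum_(mu : part n) weight mu - weight nu)%N.
elim: N nu s => // N IH nu s; rewrite ltnS => leN.
(* Up to the weight of [nu] this is the triangularity found in the group algebra; above it, the
   induction hypothesis feeds [dot_word_fix_above]. *)
have D la : dot (wf (parts nu)) (chi la) = (kk la (parts nu))%:R.
  case: (leqP (weight la) (weight nu)) => h.
    rewrite dot_word_fix //; case: (eqVneq la nu) => [->|ne].
      by rewrite gelfand_tsetlin_diag.
    by rewrite gelfand_tsetlin_eq0.
  apply: (dot_word_fix_above (w := (weight nu).+1)); rewrite ?sumn_parts //.
  move=> mu hmu t; apply: IH.
  have : (weight mu <= \sum_(mu : part n) weight mu)%N by rewrite (bigD1 mu) //= leq_addr.
  by lia.
pose e t := \sum_(la : part n) (kk la (parts nu))%:R * chi la t.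
pose r t : F := (word_fix (parts nu) t)%:R - e t.
apply/eqP; rewrite -subr_eq0 -/(e s) -/(r s); apply/eqP.
have re t : r t \is Num.real.
  rewrite rpredB ?realn // rpred_sum // => la _.
  by rewrite rpredM ?realn ?specht_char_real.
apply: dot_self_eq0 => //.
have Dr la : dot r (chi la) = 0.
  rewrite dotC dotBr dotC D dot_sumr (bigD1 la) //= dot_specht eqxx mulr1.
  rewrite big1 ?addr0 ?subrr // => k kla.
  by rewrite dot_specht eq_sym (negbTE kla) mulr0.
(* As [r] is orthogonal to every Specht character, its norm is the norm of the word character minus
   the sum of squared chain counts, and [dot_word_fix2] makes these equal. *)
rewrite dotBr dot_sumr [X in _ - X]big1 ?subr0; last by move=> la _; rewrite Dr mulr0.
rewrite dotC dotBr dot_word_fix2 ?sumn_parts // dot_sumr.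
rewrite -sumrB big1 // => la _.
by rewrite D -natrM subrr.
Qed.

Theorem young_rule a la : sumn a = n -> dot (wf a) (chi la) = (kk la a)%:R.
Proof.
move=> sa; apply: (dot_word_fix_above (w := 0)) => // nu _.
exact: word_fix_expansion.
Qed.

Lemma mean_word_fix a : sumn a = n -> n`!%:R^-1 * \sum_s wf a s = 1.
Proof.
move=> sa; have [h0 hc] : exists h0 : {ffun 'I_n -> 'I_(size a)},
    forall i, wcount h0 i = nth 0%N a i.
  by apply: exists_word; rewrite -[RHS]sa sumnE (big_nth 0%N) big_mkord.
rewrite -natr_sum -[X in _ * X%:R](_ : n`! = _) ?mulVf ?fact_neq0 //.
rewrite -(sum_wfix h0); apply: eq_bigr => s _; apply: eq_card => h.
by rewrite !inE; congr (_ && _); apply: eq_forallb => i; rewrite hc.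
Qed.

End YoungRule.

(** * Tensor powers and their centralizers *)

Section Modules.
Variables (F : fieldType) (gT : finGroupType) (G : {group gT}) (n : nat).
Variable rG : mx_representation F G n.

(** The diagonal entry at the matrix unit (i, j) is [X i i * Y j j]. *)
Lemma mxtrace_lin_mul (X Y : 'M[F]_n) :
  \tr (lin_mx (mulmxr Y \o mulmx X)) = \tr X * \tr Y.
Proof.
rewrite /mxtrace (reindex _ (curry_mxvec_bij _ _)) /=.
transitivity (\sum_i \sum_j lin_mx (mulmxr Y \o mulmx X)
   (mxvec_index i j) (mxvec_index i j)).
  by rewrite pair_bigA; apply: eq_bigr => -[i j] _.
rewrite [RHS]mulr_suml.
apply: eq_bigr => i _; rewrite mulr_sumr; apply: eq_bigr => j _.
have -> : lin_mx (mulmxr Y \o mulmx X) (mxvec_index i j) (mxvec_index i j)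
    = (X *m delta_mx i j *m Y) i j.
  rewrite -[RHS](mxvecE (X *m delta_mx i j *m Y)).
  have := mul_vec_lin (mulmxr Y \o mulmx X) (delta_mx i j).
  by rewrite /= mxvec_delta -rowE => <-; rewrite [RHS]mxE.
rewrite -(mul_delta_mx (0 : 'I_1)) mulmxA -colE -mulmxA -rowE mxE big_ord1.
by rewrite !mxE.
Qed.

(** [E] and the row base of its span are two bases of one space; the transition matrices [X] and [Y]
    conjugate one action into the other. *)
Lemma mxtrace_submod_free d (E : 'M[F]_(d, n)) (S : 'M[F]_d)
    (modE : mxmodule rG <<E>>%MS) g :
  g \in G -> row_free E -> S *m E = E *m rG g ->
  \tr (submod_repr modE g) = \tr S.
Proof.
move=> Gg freeE SE; pose B := row_base <<E>>%MS.
have BS : submod_repr modE g *m B = B *m rG g.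
  have := val_submodJ modE (1%:M : 'M[F]_(\rank <<E>>%MS)) Gg.
  by rewrite mul1mx /val_submod /= mul1mx.
have freeB : row_free B := row_base_free _.
have /submxP[Y EY] : (E <= B)%MS by rewrite eq_row_base genmxE.
have /submxP[X BX] : (B <= E)%MS by rewrite eq_row_base genmxE.
have YX : Y *m X = 1%:M.
  by apply: (row_free_inj freeE); rewrite -[LHS]/(_ *m _) -[RHS]/(_ *m _) mul1mx
    -mulmxA -BX -EY.
have XSE : submod_repr modE g *m X = X *m S.
  apply: (row_free_inj freeE); rewrite -[LHS]/(_ *m _) -[RHS]/(_ *m _).
  by rewrite -[_ *m X *m E]mulmxA -BX BS {1}BX -!mulmxA SE.
have XY : X *m Y = 1%:M.
  by apply: (row_free_inj freeB); rewrite -[LHS]/(_ *m _) -[RHS]/(_ *m _) mul1mx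
    -mulmxA -EY -BX.
have -> : \tr S = \tr (X *m S *m Y).
  by rewrite -mulmxA [RHS]mxtrace_mulC -mulmxA YX mulmx1.
by rewrite -XSE -[_ *m X *m Y]mulmxA XY mulmx1.
Qed.

Hypothesis charG : #|G|%:R != 0 :> F.

Lemma rank_cent_envelop :
  (\rank ('C(enveloping_algebra_mx rG))%MS)%:R
    = #|G|%:R^-1 * \sum_(g in G) \tr (rG g^-1%g) * \tr (rG g).
Proof.
pose P := #|G|%:R^-1 *: \sum_(g in G) lin_mx (mulmxr (rG g) \o mulmx (rG g^-1%g)).
have PE A : mxvec A *m P
    = mxvec (#|G|%:R^-1 *: \sum_(g in G) rG g^-1%g *m A *m rG g).
  rewrite /P -scalemxAr mulmx_sumr [RHS]linearZ /= [in RHS]linear_sum /=.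
  by congr (_ *: _); apply: eq_bigr => g _; rewrite mul_vec_lin.
have avgC A : centgmx rG (#|G|%:R^-1 *: \sum_(g in G) rG g^-1%g *m A *m rG g).
  apply/centgmxP=> x Gx; rewrite -scalemxAl -scalemxAr mulmx_suml mulmx_sumr.
  congr (_ *: _); rewrite [RHS](reindex_inj (mulIg x)) /=.
  apply: eq_big => [g|g Gg]; first by rewrite groupMr.
  by rewrite invMg !repr_mxM ?groupV // !mulmxA -[rG x *m rG x^-1%g]repr_mxM
    ?groupV // mulgV repr_mx1 mul1mx.
have CP A : centgmx rG A -> mxvec A *m P = mxvec A.
  move=> /centgmxP cA; rewrite PE (eq_bigr (fun=> A)) => [|g Gg].
    by rewrite sumr_const -scaler_nat scalerA mulVf ?scale1r.
  by rewrite -mulmxA cA // mulmxA -repr_mxM ?groupV // mulVg repr_mx1 mul1mx.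
have PC : (P :=: 'C(enveloping_algebra_mx rG))%MS.
  apply/eqmxP/andP; split; apply/row_subP=> i.
    rewrite rowE -[delta_mx 0 i]vec_mxK PE.
    by rewrite memmx_cent_envelop avgC.
  have cA : (vec_mx (row i 'C(enveloping_algebra_mx rG)%MS) \in
     'C(enveloping_algebra_mx rG))%MS by rewrite vec_mxK row_sub.
  rewrite memmx_cent_envelop in cA.
  by rewrite -[row i _]vec_mxK -(CP _ cA) submxMl.
have PP : P *m P = P.
  apply/row_matrixP=> i; rewrite row_mul rowE -[delta_mx 0 i]vec_mxK PE.
  by rewrite CP.
rewrite -PC -(mxtrace_idem PP) mxtraceZ linear_sum /=; congr (_ * _).
by apply: eq_bigr => g _; rewrite mxtrace_lin_mul.
Qed.

End Modules.

Section TensorPower.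
Variables (F : numFieldType) (n k : nat).

Lemma mxtrace_perm (s : 'S_n) : \tr (perm_mx s : 'M[F]_n) = (fixpts s)%:R.
Proof.
rewrite /mxtrace /fixpts -sum1_card natr_sum [RHS]big_mkcond /=.
by apply: eq_bigr => i _; rewrite !mxE inE; case: eqP.
Qed.

Lemma mxtrace_tensor_power (s : 'S_n) :
  \tr (tensor_power F n k s) = (fixpts s)%:R ^+ k.
Proof.
rewrite /tensor_power; elim: k => [|j IH] /=; first by rewrite mxtrace1.
by rewrite mxtrace_prod IH exprS mxtrace_perm.
Qed.

Lemma fixptsV (s : 'S_n) : fixpts s^-1%g = fixpts s.
Proof.
apply: eq_card => i; rewrite !inE; apply/eqP/eqP => e.
  by rewrite -{1}e permKV.
by rewrite -{1}e permK.
Qed.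

Lemma rank_Zk : (\rank (Zk F n k))%:R
  = n`!%:R^-1 * \sum_(s : 'S_n) (fixpts s)%:R ^+ (2 * k) :> F.
Proof.
rewrite /Zk rank_cent_envelop; last by rewrite cardsT card_Sn fact_neq0.
rewrite cardsT card_Sn; congr (_ * _); apply: eq_big => [s|s _]; first by rewrite inE.
by rewrite !mxtrace_tensor_power fixptsV -exprD mul2n addnn.
Qed.

Lemma Zk_decomposition_trace (Z : Zk_decomposition F n k) (s : 'S_n) :
  (fixpts s)%:R ^+ k = \sum_la (zk_dim Z la)%:R * specht_char F la s.
Proof.
(* Taking the identity of the centralizer leaves the action of the symmetric group: each summand is
   [zk_dim Z la] copies of the Specht module. *)
have embJ la g : tprod (specht F la g) 1%:M *m zk_emb Z la
    = zk_emb Z la *m tensor_power F n k g.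
  rewrite -(zk_act1 Z la) zk_embJ ?mulmx1 //.
  by rewrite memmx_cent_envelop; apply/centgmxP => x _; rewrite mul1mx mulmx1.
have modE la : mxmodule (tensor_power F n k) <<zk_emb Z la>>%MS.
  apply/mxmoduleP => g _; rewrite (eqmxMr _ (genmxE _)) genmxE -embJ.
  exact: submxMl.
have mod1 : mxmodule (tensor_power F n k) (1%:M : 'M_(tdim F n k)) := mxmodule1 _.
have := mxtrace_dsum_mod modE mod1 (zk_emb_full Z) (zk_emb_direct Z) (in_setT s).
rewrite mxtrace_submod1 ?inE // mxtrace_tensor_power => <-.
apply: eq_bigr => la _.
rewrite (mxtrace_submod_free (modE la) (in_setT s) (zk_emb_free Z la) (embJ la s)).
by rewrite mxtrace_prod mxtrace1 mulrC.
Qed.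

End TensorPower.

(** * Multiplicities in tensor powers *)

Section Multiplicities.
Variables (F : numFieldType) (n k : nat).

Lemma sumn_hook l : (l <= n)%N -> sumn (hook_content n l) = n.
Proof. by move=> ln; rewrite /= sumn_nseq mul1n subnK. Qed.

Lemma fixpts_expE (s : 'S_n) : (fixpts s)%:R ^+ k
  = \sum_(l < n.+1) (stirling2 k l)%:R * (word_fix (hook_content n l) s)%:R :> F.
Proof.
by rewrite -natrX fixpts_exp big_mkord natr_sum; apply: eq_bigr => l _; rewrite natrM.
Qed.

Lemma dot_fixpts_specht (la : part n) :
  dot (fun s : 'S_n => (fixpts s)%:R ^+ k) (specht_char F la)
    = (\sum_(0 <= l < n.+1) stirling2 k l * kostka la (hook_content n l))%:R.
Proof.
rewrite dotC (eq_dotr _ fixpts_expE) dot_sumr big_mkord natr_sum.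
apply: eq_bigr => l _; rewrite natrM kostkaE -(young_rule F) ?sumn_hook ?leq_ord //.
by rewrite dotC.
Qed.

Lemma dot_fixpts_multiplicity (Z : Zk_decomposition F n k) (la : part n) :
  dot (fun s : 'S_n => (fixpts s)%:R ^+ k) (specht_char F la) = (zk_dim Z la)%:R.
Proof.
rewrite dotC (eq_dotr _ (Zk_decomposition_trace Z)) dot_sumr (bigD1 la) //=.
rewrite dot_specht eqxx mulr1 big1 ?addr0 // => mu ne.
by rewrite dot_specht eq_sym (negbTE ne) mulr0.
Qed.

Lemma mean_fixpts_exp : n`!%:R^-1 * \sum_(s : 'S_n) (fixpts s)%:R ^+ k
  = (\sum_(0 <= l < n.+1) stirling2 k l)%:R :> F.
Proof.
rewrite (eq_bigr _ (fun s _ => fixpts_expE s)).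
rewrite exchange_big mulr_sumr big_mkord natr_sum; apply: eq_bigr => l _ /=.
by rewrite -mulr_sumr mulrCA mean_word_fix ?mulr1 // sumn_hook ?leq_ord.
Qed.

End Multiplicities.

Theorem mainTheorem8 (R : realType) (n k : nat) (hn : (1 <= n)%N)
    (hk : (1 <= k)%N) :
  (forall la : part n,
     (forall Z : Zk_decomposition R[i] n k,
        (zk_dim Z la)%:R
          = (n`!%:R)^-1 * \sum_(s : 'S_n)
              (fixpts s)%:R ^+ k * (specht_char R[i] la s)^* :> R[i])
     /\ (n`!%:R)^-1 * \sum_(s : 'S_n)
              (fixpts s)%:R ^+ k * (specht_char R[i] la s)^*
          = (\sum_(0 <= l < n.+1)
               stirling2 k l * kostka la ((n - l) :: nseq l 1))%:R :> R[i])
  /\ ((\rank (Zk R[i] n k))%:R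
        = (n`!%:R)^-1 * \sum_(s : 'S_n) (fixpts s)%:R ^+ (2 * k) :> R[i]
      /\ (n`!%:R)^-1 * \sum_(s : 'S_n) (fixpts s)%:R ^+ (2 * k)
        = (\sum_(0 <= l < n.+1) stirling2 (2 * k) l)%:R :> R[i]).
Proof.
split=> [la|]; last by split; [exact: rank_Zk | exact: mean_fixpts_exp].
(* The Specht characters are real, so the conjugate disappears and the bilinear [dot] applies. *)
have -> : (n`!%:R)^-1 * \sum_(s : 'S_n)
      (fixpts s)%:R ^+ k * (specht_char R[i] la s)^*
    = dot (fun s : 'S_n => (fixpts s)%:R ^+ k) (specht_char R[i] la).
  by congr (_ * _); apply: eq_bigr => s _; rewrite conj_Creal // specht_char_real.
by split=> [Z|]; [rewrite (dot_fixpts_multiplicity Z) | exact: dot_fixpts_specht].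
Qed.
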